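(* Let $r\ge1$, $s\ge0$ be integers, $\alpha_1,\ldots,\alpha_r\in\mathbb{C}$, $\beta_1,\ldots,\beta_s\in\mathbb{C}\setminus\mathbb{Z}_{\le0}$, $x\ge0$, $a\in[0,\infty)$, and let $\rho,\mu,\omega,p\in\mathbb{C}$ with $\Re(\rho)>0$, $\Re(\mu)>0$, $\Re(p)>0$. Let $Y\in(a,\infty]$ be such that the series defining $$ {}_{r}\Gamma_{s}\left[\begin{array}{r}(\alpha_{1},x;p),\alpha_{2},\ldots,\alpha_{r};\\ \beta_{1},\ldots,\beta_{s};\end{array}\omega(t-a)\right]$$ converges for all $t\in(a,Y)$. Then for all $y$ with $a<y<Y$, $$\left(I_{a+}^{\mu}\left\{(t-a)^{\rho-1}\,{}_{r}\Gamma_{s}\left[\begin{array}{r}(\alpha_{1},x;p),\alpha_{2},\ldots,\alpha_{r};\\ \beta_{1},\ldots,\beta_{s};\end{array}\omega(t-a)\right]\right\}\right)(y)=\frac{(y-a)^{\rho+\mu-1}\Gamma(\rho)}{\Gamma(\rho+\mu)}\;{}_{r+1}\Gamma_{s+1}\left[\begin{array}{r}(\alpha_{1},x;p),\alpha_{2},\ldots,\alpha_{r},\rho;\\ \beta_{1},\ldots,\beta_{s},\rho+\mu;\end{array}\omega(y-a)\right],$$ and, if $\rho-\mu\notin\mathbb{Z}_{\le0}$, $$\left(D_{a+}^{\mu}\left\{(t-a)^{\rho-1}\,{}_{r}\Gamma_{s}\left[\begin{array}{r}(\alpha_{1},x;p),\alpha_{2},\ldots,\alpha_{r};\\ \beta_{1},\ldots,\beta_{s};\end{array}\omega(t-a)\right]\right\}\right)(y)=\frac{(y-a)^{\rho-\mu-1}\Gamma(\rho)}{\Gamma(\rho-\mu)}\;{}_{r+1}\Gamma_{s+1}\left[\begin{array}{r}(\alpha_{1},x;p),\alpha_{2},\ldots,\alpha_{r},\rho;\\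 \beta_{1},\ldots,\beta_{s},\rho-\mu;\end{array}\omega(y-a)\right].$$
   Context: Generalized incomplete Gamma function: $\Gamma(\nu,x;p):=\int_x^\infty u^{\nu-1}e^{-u-p/u}\,du$ ($x\ge0$, $\Re(p)>0$). Extended incomplete Pochhammer symbol: $[\lambda;x,p]_\nu:=\Gamma(\lambda+\nu,x;p)/\Gamma(\lambda)$, where $1/\Gamma(\lambda)$ is read as $0$ for $\lambda\in\mathbb{Z}_{\le0}$. Ordinary Pochhammer symbol: $(\lambda)_0=1$, $(\lambda)_n=\lambda(\lambda+1)\cdots(\lambda+n-1)$. Extended incomplete generalized hypergeometric function (when the series converges; denominator parameters must lie in $\mathbb{C}\setminus\mathbb{Z}_{\le0}$): $${}_{r}\Gamma_{s}\left[\begin{array}{r}(\alpha_{1},x;p),\alpha_{2},\ldots,\alpha_{r};\\ \beta_{1},\ldots,\beta_{s};\end{array} z\right]:=\sum_{n=0}^{\infty}\frac{[\alpha_{1};x,p]_{n}(\alpha_{2})_{n}\cdots(\alpha_{r})_{n}}{(\beta_{1})_{n}\cdots(\beta_{s})_{n}}\frac{z^{n}}{n!}.$$ Riemann–Liouville fractional integral and derivative, for $\Re(\mu)>0$ and $y>a$: $$(I_{a+}^{\mu}\varphi)(y)=\frac{1}{\Gamma(\mu)}\int_a^y\frac{\varphi(t)}{(y-t)^{1-\mu}}\,dt,\qquad (D_{a+}^{\mu}\varphi)(y)=\left(\frac{d}{dy}\right)^{n}\left(I_{a+}^{n-\mu}\varphi\right)(y),\quad n=[\Re(\mu)]+1,$$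 where $[\cdot]$ is the greatest-integer function. In $I_{a+}^{\mu}\{\varphi(t)\}(y)$ the operator acts on $\varphi$ as a function of $t$ and the result is evaluated at $y$. *)

(* Defs.v *)
(* Stdlib reals with Coquelicot; complex numbers are Coquelicot's [C].
   Series, improper integrals and derivatives of [C]-valued functions are taken
   in [C] viewed as a normed module over [R]. *)
From Stdlib Require Export Reals ZArith List Lra Lia.
From Coquelicot Require Export Coquelicot.

Open Scope R_scope.

Definition nonpos_int (z : C) : Prop := exists k : nat, z = RtoC (- INR k).

Definition Cexp (z : C) : C :=
  (exp (Re z) * cos (Im z), exp (Re z) * sin (Im z)).

(* Principal power of a positive real base; junk for u <= 0. *)
Definition Rcpow (u : R) (z : C) : C := Cexp (z * RtoC (ln u))%C.

Fixpoint poch (l : C) (n : nat) : C :=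
  match n with
  | O => RtoC 1
  | S m => (poch l m * (l + RtoC (INR m)))%C
  end.

(* Both endpoints are limits, since the integrands below may be singular there. *)
Definition Cintegral (f : R -> C) (Fa Fb : (R -> Prop) -> Prop) : C :=
  RInt_gen (V := C_R_CompleteNormedModule) f Fa Fb.

Definition ex_Cseries (a : nat -> C) : Prop :=
  ex_series (V := C_R_NormedModule) a.

Definition Cseries (a : nat -> C) : C :=
  iota (T := C_R_CompleteNormedModule) (is_series (V := C_R_NormedModule) a).

Definition Gamma_integral (z : C) : C :=
  Cintegral (fun u : R => (Rcpow u (z - 1) * RtoC (exp (- u)))%C)
    (at_right 0) (Rbar_locally p_infty).

(* A shift k with 0 < Re z + k; it is 0 when 0 < Re z. *)
Definition Gamma_shift (z : C) : nat := Z.to_nat (up (- Re z)).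

(* Analytic continuation by Gamma(z) = Gamma(z + k) / (z)_k; the value is
   meaningless when z is a nonpositive integer. *)
Definition Gamma (z : C) : C :=
  let k := Gamma_shift z in
  (Gamma_integral (z + RtoC (INR k)) / poch z k)%C.

(* The entire function 1/Gamma: the factor (z)_k makes it vanish at the
   nonpositive integers. *)
Definition rGamma (z : C) : C :=
  let k := Gamma_shift z in
  (poch z k / Gamma_integral (z + RtoC (INR k)))%C.

Lemma rGamma_nonpos_int (z : C) : nonpos_int z -> rGamma z = RtoC 0.
Proof.
intros [k ->]; unfold rGamma, Gamma_shift; cbn [Re RtoC fst].
assert (E : up (- - INR k) = Z.of_nat (S k)).
{ symmetry; apply tech_up; rewrite <- INR_IZR_INZ, S_INR; lra. }
rewrite E, Nat2Z.id; cbn [poch].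
replace (RtoC (- INR k) + RtoC (INR k))%C with (RtoC 0)
  by (rewrite <- RtoC_plus; f_equal; lra).
unfold Cdiv; rewrite Cmult_0_r; apply Cmult_0_l.
Qed.

Lemma rGamma_inv (z : C) : rGamma z = (/ Gamma z)%C.
Proof.
assert (E0 : (/ RtoC 0 = RtoC 0)%C).
{ unfold Cinv, RtoC; cbn; f_equal; unfold Rdiv; ring. }
unfold rGamma, Gamma; cbv zeta.
set (g := Gamma_integral _); set (q := poch _ _); unfold Cdiv.
destruct (Ceq_dec g 0) as [-> | Hg].
{ now rewrite Cmult_0_l, E0, Cmult_0_r. }
destruct (Ceq_dec q 0) as [-> | Hq].
{ now rewrite E0, Cmult_0_r, E0, Cmult_0_l. }
field; now split.
Qed.

Definition Gamma_inc (nu : C) (x : R) (p : C) : C :=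
  Cintegral
    (fun u : R => (Rcpow u (nu - 1) * Cexp (- RtoC u - p / RtoC u))%C)
    (at_right x) (Rbar_locally p_infty).

Definition inc_poch (l : C) (x : R) (p nu : C) : C :=
  (Gamma_inc (l + nu) x p * rGamma l)%C.

Definition poch_prod (l : list C) (n : nat) : C :=
  fold_right (fun c acc : C => (poch c n * acc)%C) (RtoC 1) l.

(* [alphas] lists alpha_2, ..., alpha_r, so r = 1 + length alphas;
   s = length betas. *)
Definition rGs_term (x : R) (p alpha1 : C) (alphas betas : list C) (z : C)
    (n : nat) : C :=
  (inc_poch alpha1 x p (RtoC (INR n)) * poch_prod alphas n / poch_prod betas n
   * (z ^ n / RtoC (INR (fact n))))%C.

Definition ex_rGs (x : R) (p alpha1 : C) (alphas betas : list C) (z : C) : Prop :=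
  ex_Cseries (rGs_term x p alpha1 alphas betas z).

Definition rGs (x : R) (p alpha1 : C) (alphas betas : list C) (z : C) : C :=
  Cseries (rGs_term x p alpha1 alphas betas z).

(* (I_{a+}^mu phi)(y) exists as an improper integral and equals v. *)
Definition is_RL_integral (a : R) (mu : C) (phi : R -> C) (y : R) (v : C) : Prop :=
  exists J : C,
    is_RInt_gen (V := C_R_NormedModule)
      (fun t : R => (phi t / Rcpow (y - t) (1 - mu))%C)
      (at_right a) (at_left y) J
    /\ v = (1 / Gamma mu * J)%C.

(* f is n times differentiable at y, with n-th derivative v there; all lower
   derivatives are required to exist in a neighbourhood of y. *)
Fixpoint is_Cderive_n (f : R -> C) (n : nat) (y : R) (v : C) : Prop :=
  match n with
  | O => f y = v
  | S m => exists g : R -> C,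
      locally y (fun t : R => is_Cderive_n f m t (g t))
      /\ is_derive (K := R_AbsRing) (V := C_R_NormedModule) g y v
  end.

Definition RL_order (mu : C) : nat := Z.to_nat (Int_part (Re mu) + 1).

(* (D_{a+}^mu phi)(y) exists and equals v. *)
Definition is_RL_derivative (a : R) (mu : C) (phi : R -> C) (y : R) (v : C) : Prop :=
  exists F : R -> C,
    locally y (fun u : R =>
      is_RL_integral a (RtoC (INR (RL_order mu)) - mu)%C phi u (F u))
    /\ is_Cderive_n F (RL_order mu) y v.

(* Main.v *)
(* The series of the function is a power series in [t - a] with coefficients whose
   shape is irrelevant; it converges uniformly up to [y], so it may be integrated
   term by term against [(t - a)^(rho - 1) (y - t)^(mu - 1)], which is absolutely
   integrable.  Each term is a beta integral, and B(z, w) Gamma(z + w) =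
   Gamma(z) Gamma(w) turns the result into the Pochhammer quotient
   (rho)_k / (rho + mu)_k.  The derivative of order mu is the n-th derivative of the
   integral of order n - mu, and differentiating
   t^(s - 1) / Gamma(s) sum_k c_k (rho)_k / (s)_k t^k just replaces s by s - 1.

   The beta identity is obtained without double integrals: B(z, w) is computed from
   B(z, w + n) by the functional equation, and n^z B(z, w + n) --> Gamma(z).  It
   also yields Gamma <> 0 on the right half-plane. *)

(* Convergence is given only at real points, so the series is treated as a function of the real
   variable [t - a]: boundedness of its terms gives a radius, and the real and imaginary parts
   become two real power series, to which the real theory of convergence and differentiation
   applies.

   In the coordinate u, with t = 1 - e^(-u), the integrand of B(z, w + n) is u^(z-1) e^(-n u) times
   a factor close to 1 near u = 0. Gamma and beta integrals thus live on the same half-line and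
   share one dominating function. For w = 1 the asymptotics become Euler's limit for Gamma(z);
   Euler's limits for w and z + w then turn the case of general w into the beta identity.

   The derivative formula therefore relies on Gamma(z + 1) = z Gamma(z) for the continued function,
   and descends by unit steps from rho + n - mu, whose real part is positive. *)
Require Import Defs.
Import ListNotations.

(** * Complex-valued functions of a real variable *)

Notation CR := C_R_NormedModule.
Notation CRc := C_R_CompleteNormedModule.
Notation Cderive := (is_derive (K := R_AbsRing) (V := C_R_NormedModule)).
Notation Ccontinuous := (continuous (T := R_UniformSpace) (U := CR)).

Lemma norm_Cmod (z : C) : norm (V := CR) z = Cmod z.
Proof.
unfold Cmod; cbn; unfold prod_norm; cbn; f_equal.
change (norm (fst z)) with (Rabs (fst z)); change (norm (snd z)) with (Rabs (snd z)).
rewrite !Rmult_1_r, <- !Rabs_mult, !Rabs_pos_eq; [ring | apply Rle_0_sqr ..].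
Qed.

Lemma Cmod_le_Re_Im (z : C) : Cmod z <= Rabs (Re z) + Rabs (Im z).
Proof.
replace z with (RtoC (Re z) + RtoC (Im z) * Ci)%C at 1.
{ eapply Rle_trans; [apply Cmod_triangle|].
  rewrite Cmod_mult, !Cmod_R, Cmod_Ci; lra. }
destruct z as [u v]; unfold Ci, RtoC, Cplus, Cmult; cbn; f_equal; ring.
Qed.

Lemma im_le_Cmod (z : C) : Rabs (Im z) <= Cmod z.
Proof.
eapply Rle_trans; [| apply Rmax_Cmod]; apply Rmax_r.
Qed.

Lemma Cderive_pair (f g : R -> R) (x l m : R) :
  is_derive f x l -> is_derive g x m ->
  Cderive (fun t => (f t, g t) : C) x ((l, m) : C).
Proof.
intros Hf Hg.
apply (is_derive_ext (V := CR)
  (fun t => plus (scal (f t) ((1, 0) : CR)) (scal (g t) ((0, 1) : CR)))).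
{ intros t; unfold plus, scal; cbn; unfold prod_plus, prod_scal, scal, plus, mult; cbn;
  unfold mult; cbn; f_equal; ring. }
replace ((l, m) : CR) with (plus (scal l ((1, 0) : CR)) (scal m ((0, 1) : CR))).
{ apply (is_derive_plus (V := CR));
  [apply (is_derive_scal_l (V := CR) f) | apply (is_derive_scal_l (V := CR) g)]; easy. }
unfold plus, scal; cbn; unfold prod_plus, prod_scal, scal, plus, mult; cbn;
  unfold mult; cbn; f_equal; ring.
Qed.

Lemma Cderive_Re (f : R -> C) (x : R) (l : C) :
  Cderive f x l -> is_derive (fun t => Re (f t)) x (Re l).
Proof.
intros H.
eapply filterdiff_ext_lin.
{ apply (filterdiff_comp (U := R_NormedModule) (V := CR) (W := R_NormedModule)
    f (fun z => fst z)); [exact H |].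
  apply filterdiff_linear, is_linear_fst. }
intros y; destruct l; reflexivity.
Qed.

Lemma is_linear_Im : is_linear (K := R_AbsRing) (U := CR) (V := R_NormedModule) (fun z => snd z).
Proof.
split; [easy | easy |].
exists 1; split; [lra | intros x; rewrite norm_Cmod, Rmult_1_l; apply im_le_Cmod].
Qed.

Lemma Cderive_Im (f : R -> C) (x : R) (l : C) :
  Cderive f x l -> is_derive (fun t => Im (f t)) x (Im l).
Proof.
intros H.
eapply filterdiff_ext_lin.
{ apply (filterdiff_comp (U := R_NormedModule) (V := CR) (W := R_NormedModule)
    f (fun z => snd z)); [exact H |].
  apply filterdiff_linear, is_linear_Im. }
intros y; destruct l; reflexivity.
Qed.

Lemma Cderive_split (f : R -> C) (x : R) (l : C) :
  is_derive (fun t => Re (f t)) x (Re l) -> is_derive (fun t => Im (f t)) x (Im l) ->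
  Cderive f x l.
Proof.
intros H1 H2.
replace l with ((Re l, Im l) : C) by (now destruct l).
apply (is_derive_ext (V := CR) (fun t => (Re (f t), Im (f t)) : C)).
{ intros t; now destruct (f t). }
now apply Cderive_pair.
Qed.

Lemma Cderive_mult (f g : R -> C) (x : R) (l m : C) :
  Cderive f x l -> Cderive g x m ->
  Cderive (fun t => (f t * g t)%C) x (l * g x + f x * m)%C.
Proof.
intros Hf Hg.
pose proof (Cderive_Re _ _ _ Hf) as F1; pose proof (Cderive_Im _ _ _ Hf) as F2.
pose proof (Cderive_Re _ _ _ Hg) as G1; pose proof (Cderive_Im _ _ _ Hg) as G2.
assert (M : forall u v : R -> R, forall a b : R, is_derive u x a -> is_derive v x b ->
  is_derive (fun t => u t * v t) x (a * v x + u x * b)).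
{ intros u v a b Hu Hv; apply (is_derive_mult u v x a b Hu Hv); intros; apply Rmult_comm. }
apply Cderive_split.
- eapply (is_derive_ext (fun t => Re (f t) * Re (g t) - Im (f t) * Im (g t))).
  { intros t; reflexivity. }
  replace (Re (l * g x + f x * m)) with
    (Re l * Re (g x) + Re (f x) * Re m - (Im l * Im (g x) + Im (f x) * Im m)).
  { apply (is_derive_minus (V := R_NormedModule)); now apply M. }
  destruct l, m; unfold Cplus, Cmult, Re, Im; cbn; ring.
- eapply (is_derive_ext (fun t => Re (f t) * Im (g t) + Im (f t) * Re (g t))).
  { intros t; reflexivity. }
  replace (Im (l * g x + f x * m)) with
    (Re l * Im (g x) + Re (f x) * Im m + (Im l * Re (g x) + Im (f x) * Re m)).
  { apply (is_derive_plus (V := R_NormedModule)); now apply M. }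
  destruct l, m; unfold Cplus, Cmult, Re, Im; cbn; ring.
Qed.

Lemma Cderive_const (c : C) (x : R) : Cderive (fun _ => c) x (RtoC 0).
Proof. apply (is_derive_const (V := CR) c). Qed.

Lemma Cderive_eq (f : R -> C) (x : R) (l m : C) : Cderive f x l -> l = m -> Cderive f x m.
Proof. now intros H <-. Qed.

Lemma Cderive_scal (c : C) (f : R -> C) (x : R) (l : C) :
  Cderive f x l -> Cderive (fun t => (c * f t)%C) x (c * l)%C.
Proof.
intros H; eapply Cderive_eq;
  [exact (Cderive_mult _ _ _ _ _ (Cderive_const c x) H) | cbv beta; ring].
Qed.

Lemma Cderive_RtoC (f : R -> R) (x l : R) :
  is_derive f x l -> Cderive (fun t => RtoC (f t)) x (RtoC l).
Proof.
intros H; apply (Cderive_pair f (fun _ => 0));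
  [exact H | apply (is_derive_const (V := R_NormedModule))].
Qed.

Lemma Cderive_Cexp (f : R -> C) (x : R) (l : C) :
  Cderive f x l -> Cderive (fun t => Cexp (f t)) x (l * Cexp (f x))%C.
Proof.
intros Hf.
pose proof (Cderive_Re _ _ _ Hf) as F1; pose proof (Cderive_Im _ _ _ Hf) as F2.
unfold Cexp; apply Cderive_split; cbn.
- evar_last.
  { apply (is_derive_mult (fun t => exp (Re (f t))) (fun t => cos (Im (f t)))).
    - apply (is_derive_comp exp); [apply is_derive_exp | exact F1].
    - apply (is_derive_comp cos); [apply is_derive_cos | exact F2].
    - intros; apply Rmult_comm. }
  unfold plus, mult, scal; cbn; unfold mult, Re, Im; cbn; ring.
- evar_last.
  { apply (is_derive_mult (fun t => exp (Re (f t))) (fun t => sin (Im (f t)))).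
    - apply (is_derive_comp exp); [apply is_derive_exp | exact F1].
    - apply (is_derive_comp sin); [apply is_derive_sin | exact F2].
    - intros; apply Rmult_comm. }
  unfold plus, mult, scal; cbn; unfold mult, Re, Im; cbn; ring.
Qed.

Lemma Cderive_continuous (f : R -> C) (x : R) (l : C) : Cderive f x l -> Ccontinuous f x.
Proof.
intros H; apply (ex_derive_continuous (V := CR)); now exists l.
Qed.

(** * Complex exponential and principal powers *)

Lemma Cexp_plus (z w : C) : Cexp (z + w) = (Cexp z * Cexp w)%C.
Proof.
unfold Cexp, Cmult; destruct z as [a b], w as [c d]; cbn.
rewrite exp_plus, cos_plus, sin_plus; f_equal; ring.
Qed.

Lemma Cexp_RtoC (r : R) : Cexp (RtoC r) = RtoC (exp r).
Proof.
unfold Cexp, RtoC; cbn; rewrite cos_0, sin_0; f_equal; ring.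
Qed.

Lemma Cexp_0 : Cexp 0 = RtoC 1.
Proof. now rewrite Cexp_RtoC, exp_0. Qed.

Lemma Cmod_Cexp (z : C) : Cmod (Cexp z) = exp (Re z).
Proof.
unfold Cexp, Cmod; cbn [fst snd].
replace (_ + _) with (exp (Re z) ^ 2).
{ apply sqrt_pow2, Rlt_le, exp_pos. }
pose proof (sin2_cos2 (Im z)) as E; unfold Rsqr in E.
transitivity (exp (Re z) ^ 2 * (sin (Im z) * sin (Im z) + cos (Im z) * cos (Im z))).
{ rewrite E; ring. }
ring.
Qed.

Lemma Re_le_Cmod (z : C) : Re z <= Cmod z.
Proof. eapply Rle_trans; [apply Rle_abs | apply re_le_Cmod]. Qed.

(** e^z - 1 is the integral over [0, 1] of z e^(t z), whose modulus is at most |z| e^|z|. It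
    measures how far two exponential integrands differ. *)
Lemma Cmod_Cexp_sub_1 (z : C) : Cmod (Cexp z - 1) <= Cmod z * exp (Cmod z).
Proof.
assert (D : forall t, Cderive (fun t : R => Cexp (z * RtoC t)) t (z * Cexp (z * RtoC t))%C).
{ intros t; apply Cderive_Cexp; eapply Cderive_eq.
  { apply Cderive_scal, (Cderive_RtoC (fun t => t)), is_derive_id. }
  cbv beta; unfold one; cbn; ring. }
assert (H := is_RInt_derive (V := CRc) (fun t : R => Cexp (z * RtoC t))
  (fun t => (z * Cexp (z * RtoC t))%C) 0 1 (fun t _ => D t)
  (fun t _ => Cderive_continuous _ t _ (Cderive_scal z _ t _ (D t)))).
rewrite <- norm_Cmod.
replace (Cexp z - 1)%C with (minus (Cexp (z * 1)) (Cexp (z * 0)) : CRc)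
  by (rewrite Cmult_1_r, Cmult_0_r, Cexp_0; reflexivity).
replace (Cmod z * exp (Cmod z)) with ((1 - 0) * (Cmod z * exp (Cmod z))) by ring.
apply (norm_RInt_le_const (V := CR) _ _ _ _ _ Rle_0_1) with (2 := H).
intros t Ht; rewrite norm_Cmod, Cmod_mult, Cmod_Cexp.
apply Rmult_le_compat_l; [apply Cmod_ge_0 |].
assert (E : Re (z * RtoC t) <= Cmod z).
{ eapply Rle_trans; [apply Re_le_Cmod |].
  rewrite Cmod_mult, Cmod_R, Rabs_pos_eq by lra.
  pose proof (Cmod_ge_0 z); nra. }
destruct E as [E | ->]; [apply Rlt_le, exp_increasing, E | lra].
Qed.

Lemma exp_le (x y : R) : x <= y -> exp x <= exp y.
Proof. intros [H | ->]; [apply Rlt_le, exp_increasing, H | lra]. Qed.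

Lemma Cexp_neq_0 (z : C) : Cexp z <> 0.
Proof. apply Cmod_gt_0; rewrite Cmod_Cexp; apply exp_pos. Qed.

Lemma Rcpow_neq_0 (u : R) (z : C) : Rcpow u z <> 0.
Proof. apply Cexp_neq_0. Qed.

Lemma Rcpow_plus (u : R) (z w : C) : Rcpow u (z + w) = (Rcpow u z * Rcpow u w)%C.
Proof. unfold Rcpow; rewrite <- Cexp_plus; f_equal; ring. Qed.

Lemma Rcpow_0 (u : R) : Rcpow u 0 = RtoC 1.
Proof. unfold Rcpow; rewrite Cmult_0_l; apply Cexp_0. Qed.

Lemma Rcpow_RtoC (u r : R) : Rcpow u (RtoC r) = RtoC (Rpower u r).
Proof. unfold Rcpow, Rpower; now rewrite <- RtoC_mult, Cexp_RtoC. Qed.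

Lemma Rcpow_1 (u : R) : 0 < u -> Rcpow u 1 = RtoC u.
Proof. intros H; rewrite Rcpow_RtoC, Rpower_1; trivial. Qed.

Lemma Rcpow_INR (u : R) (n : nat) : 0 < u -> Rcpow u (RtoC (INR n)) = RtoC (u ^ n).
Proof. intros H; rewrite Rcpow_RtoC, Rpower_pow; trivial. Qed.

Lemma Rcpow_succ (u : R) (z : C) : 0 < u -> Rcpow u z = (RtoC u * Rcpow u (z - 1))%C.
Proof.
intros H; rewrite <- (Rcpow_1 u H), <- Rcpow_plus; f_equal; ring.
Qed.

Lemma Rcpow_opp (u : R) (z : C) : Rcpow u (- z) = (/ Rcpow u z)%C.
Proof.
assert (E : (Rcpow u (- z) * Rcpow u z = 1)%C).
{ rewrite <- Rcpow_plus, <- (Rcpow_0 u); f_equal; ring. }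
rewrite <- (Cmult_1_l (/ Rcpow u z)), <- E; field; apply Rcpow_neq_0.
Qed.

Lemma Rcpow_mult_base (u v : R) (z : C) : 0 < u -> 0 < v ->
  Rcpow (u * v) z = (Rcpow u z * Rcpow v z)%C.
Proof.
intros Hu Hv; unfold Rcpow; rewrite ln_mult, RtoC_plus, <- Cexp_plus by trivial.
f_equal; ring.
Qed.

Lemma Re_mult_RtoC (z : C) (r : R) : Re (z * RtoC r) = Re z * r.
Proof. unfold Re, Cmult, RtoC; cbn; ring. Qed.

Lemma Cmod_Rcpow (u : R) (z : C) : Cmod (Rcpow u z) = Rpower u (Re z).
Proof. unfold Rcpow, Rpower; now rewrite Cmod_Cexp, Re_mult_RtoC. Qed.

Lemma Cderive_Rcpow (z : C) (f : R -> R) (t l : R) : 0 < f t -> is_derive f t l ->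
  Cderive (fun t => Rcpow (f t) z) t (z * Rcpow (f t) (z - 1) * RtoC l)%C.
Proof.
intros Hu Hf; unfold Rcpow at 1.
eapply Cderive_eq.
{ apply Cderive_Cexp, Cderive_scal, (Cderive_RtoC (fun t => ln (f t))).
  apply (is_derive_comp ln f); [apply is_derive_ln, Hu | exact Hf]. }
cbv beta; fold (Rcpow (f t) z); rewrite (Rcpow_succ (f t) z Hu).
unfold scal; cbn; unfold mult; cbn; rewrite RtoC_mult, RtoC_inv by lra.
field; intros E; apply RtoC_inj in E; lra.
Qed.

(** * Improper integrals *)

(* An open interval [D] whose two ends are approached along [Fa] and [Fb]. *)
Definition ends (D : R -> Prop) (Fa Fb : (R -> Prop) -> Prop) : Prop :=
  (forall x y t, D x -> D y -> x <= t <= y -> D t) /\ Fa D /\ Fb D /\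
  filter_prod Fa Fb (fun ab : R * R => fst ab <= snd ab).

Lemma ends_half_line : ends (fun t => 0 < t) (at_right 0) (Rbar_locally p_infty).
Proof.
split; [intros; lra | split; [| split]].
- exists (mkposreal 1 Rlt_0_1); now intros.
- exists 0; now intros.
- apply Filter_prod with (fun t => t < 1) (fun t => 1 < t).
  + exists (mkposreal 1 Rlt_0_1); cbn; intros t Ht _.
    unfold ball in Ht; cbn in Ht; unfold AbsRing_ball, abs, minus, plus, opp in Ht; cbn in Ht.
    apply Rabs_def2 in Ht; lra.
  + exists 1; now intros.
  + cbn; intros; lra.
Qed.

Lemma ends_segment (a b : R) : a < b ->
  ends (fun t => a < t < b) (at_right a) (at_left b).
Proof.
intros H.
assert (L : forall c t (e : posreal), ball c e t -> c - e < t < c + e).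
{ intros c t e Ht.
  unfold ball in Ht; cbn in Ht; unfold AbsRing_ball, abs, minus, plus, opp in Ht; cbn in Ht.
  apply Rabs_def2 in Ht; lra. }
assert (Hh : 0 < (b - a) / 2) by lra.
split; [intros; lra | split; [| split]].
- exists (mkposreal _ Hh); intros t Ht Hat; apply L in Ht; cbn in Ht; lra.
- exists (mkposreal _ Hh); intros t Ht Hat; apply L in Ht; cbn in Ht; lra.
- apply Filter_prod with (fun t => t < (a + b) / 2) (fun t => (a + b) / 2 < t).
  + exists (mkposreal _ Hh); intros t Ht Hat; apply L in Ht; cbn in Ht; lra.
  + exists (mkposreal _ Hh); intros t Ht Hat; apply L in Ht; cbn in Ht; lra.
  + cbn; intros; lra.
Qed.

Lemma ends_between (D : R -> Prop) Fa Fb (E : ends D Fa Fb) (x y t : R) :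
  D x -> D y -> Rmin x y <= t <= Rmax x y -> D t.
Proof.
destruct E as [E _]; intros Hx Hy.
unfold Rmin, Rmax; destruct (Rle_dec x y); intros Ht; [now apply (E x y) | now apply (E y x)].
Qed.

Lemma ends_prod (D : R -> Prop) Fa Fb (P : R * R -> Prop)
  {FFa : Filter Fa} {FFb : Filter Fb} : ends D Fa Fb ->
  (forall x y, D x -> D y -> x <= y -> P (x, y)) -> filter_prod Fa Fb P.
Proof.
intros [_ [Ha [Hb [Q1 Q2 H1 H2 H]]]] HP.
apply Filter_prod with (fun x => D x /\ Q1 x) (fun x => D x /\ Q2 x).
- now apply filter_and.
- now apply filter_and.
- intros x y [Hx Hx'] [Hy Hy']; apply HP; trivial; now apply (H x y).
Qed.

Lemma is_RInt_gen_ext_on {V : NormedModule R_AbsRing} (D : R -> Prop) Fa Fb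
  {FFa : Filter Fa} {FFb : Filter Fb} (f g : R -> V) (l : V) :
  ends D Fa Fb -> (forall x, D x -> f x = g x) ->
  is_RInt_gen f Fa Fb l -> is_RInt_gen g Fa Fb l.
Proof.
intros E H; apply is_RInt_gen_ext.
apply (ends_prod D _ _ _ E); intros x y Hx Hy _ t Ht; apply H.
apply (ends_between D _ _ E x y); trivial; cbn in *; lra.
Qed.

(** Passage to the limit in the fundamental theorem on compact subintervals: the primitive needs
    limits, not values, at the two ends. *)
Lemma is_RInt_gen_derive {V : CompleteNormedModule R_AbsRing} (D : R -> Prop) Fa Fb
  {FFa : Filter Fa} {FFb : Filter Fb} (f df : R -> V) (la lb : V) :
  ends D Fa Fb -> (forall x, D x -> is_derive f x (df x)) ->
  (forall x, D x -> continuous df x) ->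
  filterlim f Fa (locally la) -> filterlim f Fb (locally lb) ->
  is_RInt_gen df Fa Fb (minus lb la).
Proof.
intros E Hf Hdf Ha Hb P HP.
assert (L : filterlim (fun ab : R * R => minus (f (snd ab)) (f (fst ab)))
  (filter_prod Fa Fb) (locally (minus lb la))).
{ apply (filterlim_comp_2 (G := locally lb) (H := locally (opp la))
    (fun ab : R * R => f (snd ab)) (fun ab : R * R => opp (f (fst ab))) plus).
  - apply (filterlim_comp _ _ _ snd f _ Fb); [apply filterlim_snd | exact Hb].
  - apply (filterlim_comp _ _ _ (fun ab : R * R => f (fst ab)) opp _ (locally la)).
    + apply (filterlim_comp _ _ _ fst f _ Fa); [apply filterlim_fst | exact Ha].
    + apply (filterlim_opp (V := V) la).
  - apply (filterlim_plus (V := V) lb (opp la)). }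
specialize (L P HP).
assert (N : filter_prod Fa Fb (fun ab : R * R =>
  is_RInt df (fst ab) (snd ab) (minus (f (snd ab)) (f (fst ab))))).
{ apply (ends_prod D _ _ _ E); cbn; intros x y Hx Hy _.
  apply is_RInt_derive; intros t Ht; [apply Hf | apply Hdf];
  now apply (ends_between D _ _ E x y). }
unfold filtermap in L; unfold filtermapi; generalize (filter_and _ _ L N); apply filter_imp.
intros ab [H1 H2]; now exists (minus (f (snd ab)) (f (fst ab))).
Qed.

(** Serves both the real part and multiplication by a complex constant, which is not a scalar
    multiplication of the module over [R]. Commutation with proper integrals is a premise because it
    is proved separately for each map. *)
Lemma is_RInt_gen_linear {U V : NormedModule R_AbsRing} Fa Fb
  {FFa : Filter Fa} {FFb : Filter Fb} (T : U -> V) (f : R -> U) (l : U) :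
  is_linear T ->
  (forall a b m, is_RInt f a b m -> is_RInt (fun t => T (f t)) a b (T m)) ->
  is_RInt_gen f Fa Fb l -> is_RInt_gen (fun t => T (f t)) Fa Fb (T l).
Proof.
intros HT HI H P HP.
assert (C := linear_cont T l HT P HP).
specialize (H _ C); unfold filtermapi in *; revert H; apply filter_imp.
intros ab [m [Hm Pm]]; exists (T m); split; [now apply HI | exact Pm].
Qed.

Lemma is_linear_Cmult (c : C) :
  is_linear (K := R_AbsRing) (U := CR) (V := CR) (fun z => (c * z)%C).
Proof.
split.
- intros x y; unfold plus; cbn; unfold prod_plus, plus; cbn.
  destruct c, x, y; unfold Cmult; cbn; f_equal; ring.
- intros k x; unfold scal; cbn; unfold prod_scal, scal; cbn; unfold mult; cbn.
  destruct c, x; unfold Cmult; cbn; f_equal; ring.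
- exists (Cmod c + 1); split; [pose proof (Cmod_ge_0 c); lra |].
  intros x; rewrite !norm_Cmod, Cmod_mult.
  apply Rmult_le_compat_r; [apply Cmod_ge_0 | lra].
Qed.

Lemma is_RInt_Cmult (c : C) (f : R -> C) (a b : R) (l : C) :
  is_RInt (V := CR) f a b l -> is_RInt (V := CR) (fun t => (c * f t)%C) a b (c * l)%C.
Proof.
intros H.
pose proof (is_RInt_fct_extend_fst (U := R_NormedModule) (V := R_NormedModule) f a b l H) as H1.
pose proof (is_RInt_fct_extend_snd (U := R_NormedModule) (V := R_NormedModule) f a b l H) as H2.
apply (is_RInt_fct_extend_pair (U := R_NormedModule) (V := R_NormedModule)); cbn.
- apply (is_RInt_minus (V := R_NormedModule));
  apply (is_RInt_scal (V := R_NormedModule)); assumption.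
- apply (is_RInt_plus (V := R_NormedModule));
  apply (is_RInt_scal (V := R_NormedModule)); assumption.
Qed.

Lemma is_RInt_gen_Cmult Fa Fb {FFa : Filter Fa} {FFb : Filter Fb} (c : C) (f : R -> C) (l : C) :
  is_RInt_gen (V := CR) f Fa Fb l ->
  is_RInt_gen (V := CR) (fun t => (c * f t)%C) Fa Fb (c * l)%C.
Proof.
apply (is_RInt_gen_linear (U := CR) (V := CR) _ _ (fun z => (c * z)%C)).
- apply is_linear_Cmult.
- intros; now apply is_RInt_Cmult.
Qed.

Lemma is_RInt_gen_Re Fa Fb {FFa : Filter Fa} {FFb : Filter Fb} (f : R -> C) (l : C) :
  is_RInt_gen (V := CR) f Fa Fb l -> is_RInt_gen (fun t => Re (f t)) Fa Fb (Re l).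
Proof.
apply (is_RInt_gen_linear (U := CR) (V := R_NormedModule) _ _ (fun z => fst z)).
- apply is_linear_fst.
- intros a b m; apply (is_RInt_fct_extend_fst (U := R_NormedModule) (V := R_NormedModule)).
Qed.

(** [Rabs m] covers both orders of the bounds: in the Cauchy estimate below, an end piece may be
    traversed backwards. *)
Lemma norm_RInt_dom (f : R -> C) (g : R -> R) (a b m : R) (l : C) :
  (forall t, Rmin a b <= t <= Rmax a b -> Cmod (f t) <= g t) ->
  is_RInt (V := CR) f a b l -> is_RInt g a b m -> Cmod l <= Rabs m.
Proof.
unfold Rmin, Rmax; destruct (Rle_dec a b) as [H | H]; intros B Hf Hg.
- eapply Rle_trans; [| apply Rle_abs].
  rewrite <- norm_Cmod; apply (norm_RInt_le (V := CR) f g a b); trivial.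
  intros; rewrite norm_Cmod; auto.
- apply is_RInt_swap in Hf; apply is_RInt_swap in Hg.
  rewrite <- Rabs_Ropp, <- norm_Cmod, <- norm_opp; eapply Rle_trans; [| apply Rle_abs].
  apply (norm_RInt_le (V := CR) f g b a); trivial; [lra |].
  intros; rewrite norm_Cmod; auto.
Qed.

(** Cauchy criterion: the integrals over [x, y] and [x', y'] differ by two end pieces, and each
    piece of [f] is controlled by the same piece of [g], which is small since the integral of [g]
    converges. *)
Lemma ex_RInt_gen_dom (D : R -> Prop) Fa Fb {FFa : ProperFilter Fa} {FFb : ProperFilter Fb}
  (f : R -> C) (g : R -> R) : ends D Fa Fb ->
  (forall x, D x -> Ccontinuous f x) -> (forall x, D x -> continuous g x) ->
  (forall x, D x -> Cmod (f x) <= g x) -> ex_RInt_gen g Fa Fb ->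
  exists l : C, is_RInt_gen (V := CR) f Fa Fb l.
Proof.
intros E Cf Cg B [l Hl].
assert (If : forall x y, D x -> D y -> ex_RInt (V := CRc) f x y).
{ intros x y Hx Hy; apply ex_RInt_continuous; intros; apply Cf.
  now apply (ends_between D _ _ E x y). }
assert (Ig : forall x y, D x -> D y -> ex_RInt (V := R_CompleteNormedModule) g x y).
{ intros x y Hx Hy; apply ex_RInt_continuous; intros; apply Cg.
  now apply (ends_between D _ _ E x y). }
assert (Bd : forall x y, D x -> D y ->
  Cmod (RInt (V := CRc) f x y) <= Rabs (RInt (V := R_CompleteNormedModule) g x y)).
{ intros x y Hx Hy; apply (norm_RInt_dom f g x y).
  - intros; apply B; now apply (ends_between D _ _ E x y).
  - apply (RInt_correct (V := CRc)), If; trivial.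
  - apply (RInt_correct (V := R_CompleteNormedModule)), Ig; trivial. }
apply (filterlimi_locally_cauchy (U := CRc)).
{ apply (ends_prod D _ _ _ E); cbn; intros x y Hx Hy _; split.
  - now apply If.
  - intros y1 y2 H1 H2.
    rewrite <- (is_RInt_unique (V := CRc) _ _ _ _ H1); apply (is_RInt_unique (V := CRc)), H2. }
intros eps.
(* Each end piece of [g] is a difference of two integrals within [eps / 4] of [l], hence below
   [eps / 2]; there are two pieces. *)
assert (He : 0 < eps / 4) by (pose proof (cond_pos eps); lra).
destruct (Hl _ (locally_ball l (mkposreal _ He))) as [Q1 Q2 H1 H2 H].
assert (Cg2 : forall x y, Q1 x -> D x -> Q2 y -> D y ->
  Rabs (RInt (V := R_CompleteNormedModule) g x y - l) < eps / 4).
{ intros x y h1 h2 h3 h4; destruct (H x y h1 h3) as [m [Hm Bm]]; cbn [fst snd] in Hm.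
  rewrite (is_RInt_unique (V := R_CompleteNormedModule) _ _ _ _ Hm); exact Bm. }
destruct E as [E0 [Ea [Eb _]]].
exists (fun ab => (D (fst ab) /\ Q1 (fst ab)) /\ (D (snd ab) /\ Q2 (snd ab))).
split.
{ apply Filter_prod with (fun x => D x /\ Q1 x) (fun x => D x /\ Q2 x);
  [now apply filter_and | now apply filter_and | tauto]. }
intros [x y] [x' y']; cbn; intros [[h1 h2] [h3 h4]] [[h5 h6] [h7 h8]] u v Hu Hv.
rewrite <- (is_RInt_unique (V := CRc) _ _ _ _ Hu), <- (is_RInt_unique (V := CRc) _ _ _ _ Hv).
apply (norm_compat1 (V := CR)).
assert (CI : (RInt (V := CRc) f x' y' - RInt (V := CRc) f x y =
  RInt (V := CRc) f x' x + RInt (V := CRc) f y y')%C).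
{ rewrite <- (RInt_Chasles (V := CRc) f x' x y') by auto.
  rewrite <- (RInt_Chasles (V := CRc) f x y y') by auto.
  generalize (RInt (V := CRc) f x' x) (RInt (V := CRc) f x y) (RInt (V := CRc) f y y').
  intros p q r; change (p + (q + r) - q = p + r)%C; ring. }
rewrite norm_Cmod.
change (Cmod (RInt (V := CRc) f x' y' - RInt (V := CRc) f x y)%C < eps).
rewrite CI; eapply Rle_lt_trans; [apply Cmod_triangle |].
set (I := RInt (V := R_CompleteNormedModule) g : R -> R -> R) in *.
assert (K : forall u v w, D u -> D v -> D w -> I u v + I v w = I u w).
{ intros; apply (RInt_Chasles (V := R_CompleteNormedModule)); auto. }
clearbody I.
pose proof (K x' x y h5 h1 h3); pose proof (K x y y' h1 h3 h7).
pose proof (Rabs_def2 _ _ (Cg2 x y h2 h1 h4 h3)).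
pose proof (Rabs_def2 _ _ (Cg2 x' y h6 h5 h4 h3)).
pose proof (Rabs_def2 _ _ (Cg2 x y' h2 h1 h8 h7)).
assert (Rabs (I x' x) < eps / 2) by (apply Rabs_def1; lra).
assert (Rabs (I y y') < eps / 2) by (apply Rabs_def1; lra).
pose proof (Bd x' x h5 h1); pose proof (Bd y y' h3 h7); lra.
Qed.

Lemma is_RInt_gen_dom_le (D : R -> Prop) Fa Fb {FFa : ProperFilter Fa} {FFb : ProperFilter Fb}
  (f : R -> C) (g : R -> R) (l : C) (m : R) : ends D Fa Fb ->
  (forall x, D x -> Cmod (f x) <= g x) ->
  is_RInt_gen (V := CR) f Fa Fb l -> is_RInt_gen g Fa Fb m -> Cmod l <= m.
Proof.
intros E B Hf Hg; rewrite <- norm_Cmod.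
apply (RInt_gen_norm (V := CRc) (Fa := Fa) (Fb := Fb) f g); trivial.
- destruct E as [_ [_ [_ E]]]; exact E.
- apply (ends_prod D _ _ _ E); cbn; intros x y Hx Hy _ t Ht.
  eapply Rle_trans; [right; apply norm_Cmod | apply B].
  destruct E as [E _]; now apply (E x y).
Qed.

(** The substitution is made on compact subintervals of [D] only; the ends are matched by the limits
    of [h], which may therefore send a finite end to infinity. *)
Lemma is_RInt_gen_comp (D D' : R -> Prop) Fa Fb Ga Gb
  {FFa : ProperFilter Fa} {FFb : ProperFilter Fb} (f : R -> C) (h dh : R -> R) (l : C) :
  ends D Fa Fb -> (forall t, D t -> D' (h t)) ->
  (forall u, D' u -> Ccontinuous f u) ->
  (forall t, D t -> is_derive h t (dh t)) -> (forall t, D t -> continuous dh t) ->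
  filterlim h Fa Ga -> filterlim h Fb Gb ->
  is_RInt_gen (V := CR) f Ga Gb l ->
  is_RInt_gen (V := CR) (fun t => (RtoC (dh t) * f (h t))%C) Fa Fb l.
Proof.
intros E HD Cf Dh Cdh La Lb Hl P HP.
destruct (Hl P HP) as [Q1 Q2 H1 H2 H].
specialize (La _ H1); specialize (Lb _ H2); unfold filtermap in *.
pose proof E as E'; destruct E' as [E0 [Ea [Eb _]]].
apply Filter_prod with (fun x => D x /\ Q1 (h x)) (fun x => D x /\ Q2 (h x));
  [now apply filter_and | now apply filter_and |].
cbn; intros x y [h1 h2] [h3 h4].
destruct (H _ _ h2 h4) as [m [Hm Pm]]; cbn in Hm; exists m; split; [| exact Pm].
rewrite <- (is_RInt_unique (V := CRc) _ _ _ _ Hm).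
eapply (is_RInt_ext (V := CR)); [| apply (is_RInt_comp (V := CRc) f h dh x y)].
- cbn; intros t _; unfold scal; cbn; unfold prod_scal, scal; cbn; unfold mult; cbn.
  unfold Cmult, RtoC; cbn; f_equal; ring.
- intros t Ht; apply Cf, HD; now apply (ends_between D _ _ E x y).
- intros t Ht; assert (D t) by now apply (ends_between D _ _ E x y).
  split; auto.
Qed.

Lemma filterlim_C_dom {T : Type} (F : (T -> Prop) -> Prop) {FF : Filter F}
  (f : T -> C) (g : T -> R) (l : C) :
  F (fun x => Cmod (f x - l) <= g x) -> filterlim g F (locally 0) ->
  filterlim f F (locally (l : CR)).
Proof.
intros H Hg; apply (filterlim_locally (U := CR)); intros eps.
apply (proj1 (filterlim_locally g 0)) with (eps := eps) in Hg.
generalize (filter_and _ _ H Hg); apply filter_imp; intros x [H1 H2].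
apply (norm_compat1 (V := CR)); rewrite norm_Cmod.
eapply Rle_lt_trans; [exact H1 |].
unfold ball in H2; cbn in H2; unfold AbsRing_ball, abs, minus, plus, opp in H2; cbn in H2.
apply Rabs_def2 in H2; lra.
Qed.

Lemma Rpower_lim_0 (s : R) : 0 < s ->
  filterlim (fun u => Rpower u s) (at_right 0) (locally 0).
Proof.
intros Hs.
apply (filterlim_comp _ _ _ (fun u => s * ln u) exp _ (Rbar_locally m_infty));
  [| apply is_lim_exp_m].
apply (filterlim_comp _ _ _ ln (fun v => s * v) _ (Rbar_locally m_infty));
  [apply is_lim_ln_0 |].
intros P [M HM]; exists (M / s); intros x Hx; apply HM.
apply (Rmult_lt_compat_l s) in Hx; trivial; replace (s * (M / s)) with M in Hx by (field; lra); lra.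
Qed.

Lemma Rpower_lim_inf (s : R) : 0 < s ->
  filterlim (fun u => Rpower u s) (Rbar_locally p_infty) (Rbar_locally p_infty).
Proof.
intros Hs.
apply (filterlim_comp _ _ _ (fun u => s * ln u) exp _ (Rbar_locally p_infty));
  [| apply is_lim_exp_p].
apply (filterlim_comp _ _ _ ln (fun v => s * v) _ (Rbar_locally p_infty));
  [apply is_lim_ln_p |].
intros P [M HM]; exists (M / s); intros x Hx; apply HM.
apply (Rmult_lt_compat_l s) in Hx; trivial; replace (s * (M / s)) with M in Hx by (field; lra); lra.
Qed.

Lemma is_derive_Rpower (f : R -> R) (s u l : R) : 0 < f u -> is_derive f u l ->
  is_derive (fun u => Rpower (f u) s) u (s * Rpower (f u) (s - 1) * l).
Proof.
intros Hu Hf.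
pose proof (Cderive_Re _ _ _ (Cderive_Rcpow (RtoC s) f u l Hu Hf)) as H.
rewrite <- RtoC_minus, Rcpow_RtoC, <- !RtoC_mult in H.
eapply is_derive_ext; [| exact H].
intros t; cbv beta; now rewrite Rcpow_RtoC.
Qed.

(** This function behaves like u^(s-1) at 0 and like u^(-s-1) at infinity and has an elementary
    primitive, so it dominates at both ends without splitting the half-line. *)
Lemma continuous_dominator (s u : R) : 0 < u ->
  continuous (fun u => Rpower u (s - 1) / (1 + Rpower u s) ^ 2) u.
Proof.
intros Hu; pose proof (exp_pos (s * ln u)).
apply (ex_derive_continuous (V := R_NormedModule)); unfold Rpower.
auto_derive; repeat split; trivial; nra.
Qed.

(* [- / (s (1 + u^s))] is a primitive of [u^(s-1) / (1 + u^s)^2]. *)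
Lemma is_RInt_gen_dominator (s : R) : 0 < s ->
  is_RInt_gen (fun u => Rpower u (s - 1) / (1 + Rpower u s) ^ 2)
    (at_right 0) (Rbar_locally p_infty) (/ s).
Proof.
intros Hs.
assert (P : forall u, 0 < Rpower u s) by (intros; apply exp_pos).
replace (/ s) with (minus 0 (- / s)) by (unfold minus, plus, opp; cbn; ring).
apply (is_RInt_gen_derive (V := R_CompleteNormedModule) (fun t => 0 < t) _ _
  (fun u => - / s * / (1 + Rpower u s))).
- apply ends_half_line.
- intros u Hu; specialize (P u); evar_last.
  { apply (is_derive_scal (fun u => / (1 + Rpower u s))).
    apply (is_derive_inv (fun u => 1 + Rpower u s)); [| lra].
    apply (is_derive_plus (V := R_NormedModule) (fun _ => 1));
      [apply (is_derive_const (V := R_NormedModule)) |].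
    apply (is_derive_Rpower (fun u => u) s u 1 Hu); apply (is_derive_id (K := R_AbsRing)). }
  unfold plus, zero; cbn; field; lra.
- intros u Hu; now apply continuous_dominator.
- apply (filterlim_comp _ _ _ (fun u => Rpower u s) (fun v => - / s * / (1 + v)) _ (locally 0)).
  { now apply Rpower_lim_0. }
  assert (L : continuous (fun v => - / s * / (1 + v)) 0).
  { apply (ex_derive_continuous (V := R_NormedModule)); auto_derive; lra. }
  unfold continuous in L; replace (- / s * / (1 + 0)) with (- / s) in L by (field; lra).
  exact L.
- apply (filterlim_comp _ _ _ (fun u => Rpower u s) (fun v => - / s * / (1 + v)) _
    (Rbar_locally p_infty)).
  { now apply Rpower_lim_inf. }
  apply filterlim_locally; intros eps.
  exists (/ (s * eps)); intros v Hv.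
  pose proof (cond_pos eps).
  assert (0 < / (s * eps)) by (apply Rinv_0_lt_compat; nra).
  unfold ball; cbn; unfold AbsRing_ball, abs, minus, plus, opp; cbn.
  replace (- / s * / (1 + v) + - 0) with (- (/ (s * (1 + v)))) by (field; lra).
  rewrite Rabs_Ropp, Rabs_pos_eq by (apply Rlt_le, Rinv_0_lt_compat; nra).
  apply (Rmult_lt_reg_r (s * (1 + v))); [nra |].
  rewrite Rinv_l by nra.
  apply (Rmult_lt_compat_l (s * eps)) in Hv; [| nra].
  rewrite Rinv_r in Hv by nra; nra.
Qed.

Lemma ln_le_sub_1 (v : R) : 0 < v -> ln v <= v - 1.
Proof.
intros Hv; pose proof (exp_ineq1_le (ln v)) as H; rewrite exp_ln in H; lra.
Qed.

(** [s * ln u - c * u] is largest at u = s / c. The bound is ln v <= v - 1 at v = c u / s, with a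
    factor e^(-s) discarded. *)
Lemma Rpower_le_exp (s c u : R) : 0 < s -> 0 < c -> 0 < u ->
  Rpower u s <= Rpower (s / c) s * exp (c * u).
Proof.
intros Hs Hc Hu; unfold Rpower; rewrite <- exp_plus; apply exp_le.
assert (0 < s / c) by (apply Rdiv_lt_0_compat; lra).
replace u with (s / c * (c * u / s)) at 1 by (field; lra).
assert (0 < c * u / s) by (apply Rdiv_lt_0_compat; nra).
rewrite ln_mult by lra.
pose proof (ln_le_sub_1 (c * u / s) ltac:(lra)).
assert (s * ln (c * u / s) <= s * (c * u / s - 1)) by (apply Rmult_le_compat_l; lra).
replace (s * (c * u / s - 1)) with (c * u - s) in * by (field; lra); lra.
Qed.

Lemma ex_RInt_gen_gamma_dom (f : R -> C) (M s c : R) : 0 < s -> 0 < c -> 0 <= M ->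
  (forall u, 0 < u -> Ccontinuous f u) ->
  (forall u, 0 < u -> Cmod (f u) <= M * (Rpower u (s - 1) * exp (- (c * u)))) ->
  exists l : C, is_RInt_gen (V := CR) f (at_right 0) (Rbar_locally p_infty) l.
Proof.
intros Hs Hc HM Cf Bf.
(* Half of the decay rate gives 1 + u^s <= k e^(c u / 2); squaring, e^(-c u) <= k^2 / (1 + u^s)^2,
   so the dominating function applies with the factor [M * k ^ 2]. *)
set (k := 1 + Rpower (s / (c / 2)) s).
assert (Hk : 0 < k) by (pose proof (exp_pos (s * ln (s / (c / 2)))); unfold k, Rpower; lra).
apply (ex_RInt_gen_dom (fun t => 0 < t) _ _ f
  (fun u => (M * k ^ 2) * (Rpower u (s - 1) / (1 + Rpower u s) ^ 2))).
- apply ends_half_line.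
- exact Cf.
- intros u Hu.
  apply (continuous_scal_r (K := R_AbsRing) (V := R_NormedModule)).
  now apply continuous_dominator.
- intros u Hu; eapply Rle_trans; [now apply Bf |].
  assert (P : 0 < Rpower u s) by apply exp_pos.
  assert (P1 : 0 < Rpower u (s - 1)) by apply exp_pos.
  rewrite Rmult_assoc; apply Rmult_le_compat_l; trivial.
  replace (k ^ 2 * (Rpower u (s - 1) / (1 + Rpower u s) ^ 2))
    with (Rpower u (s - 1) * (k ^ 2 / (1 + Rpower u s) ^ 2)) by (field; lra).
  apply Rmult_le_compat_l; [lra |].
  apply (Rmult_le_reg_r ((1 + Rpower u s) ^ 2)); [apply pow_lt; lra |].
  replace (k ^ 2 / (1 + Rpower u s) ^ 2 * (1 + Rpower u s) ^ 2) with (k ^ 2) by (field; lra).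
  assert (B : 1 + Rpower u s <= k * exp (c / 2 * u)).
  { pose proof (Rpower_le_exp s (c / 2) u Hs ltac:(lra) Hu).
    assert (1 <= exp (c / 2 * u)) by (rewrite <- exp_0; apply exp_le; nra).
    unfold k; lra. }
  assert (E : exp (- (c * u)) * exp (c / 2 * u) ^ 2 = 1).
  { cbn; rewrite Rmult_1_r, <- !exp_plus, <- exp_0; f_equal; field. }
  apply Rle_trans with (exp (- (c * u)) * (k * exp (c / 2 * u)) ^ 2).
  + apply Rmult_le_compat_l; [apply Rlt_le, exp_pos | apply pow_incr; lra].
  + right; transitivity (k ^ 2 * (exp (- (c * u)) * exp (c / 2 * u) ^ 2)); [ring |].
    rewrite E; ring.
- exists (scal (M * k ^ 2) (/ s)).
  apply (is_RInt_gen_scal (V := R_NormedModule)), is_RInt_gen_dominator, Hs.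
Qed.

(** * Gamma and beta integrals *)

Definition is_half_line_RInt (f : R -> C) (l : C) : Prop :=
  is_RInt_gen (V := CR) f (at_right 0) (Rbar_locally p_infty) l.

Lemma Cintegral_half_line (f : R -> C) (l : C) :
  is_half_line_RInt f l -> Cintegral f (at_right 0) (Rbar_locally p_infty) = l.
Proof. intros H; apply (is_RInt_gen_unique (V := CRc)), H. Qed.

Lemma is_half_line_RInt_inj (f : R -> C) (l m : C) :
  is_half_line_RInt f l -> is_half_line_RInt f m -> l = m.
Proof.
intros Hl Hm; rewrite <- (Cintegral_half_line f l Hl); now apply Cintegral_half_line.
Qed.

Lemma is_half_line_RInt_ext (f g : R -> C) (l m : C) :
  (forall u, 0 < u -> f u = g u) -> l = m ->
  is_half_line_RInt f l -> is_half_line_RInt g m.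
Proof.
intros E <- H.
exact (is_RInt_gen_ext_on (V := CR) _ _ _ f g l ends_half_line E H).
Qed.

Lemma is_RInt_gen_lin Fa Fb {FFa : Filter Fa} {FFb : Filter Fb} (c d : C) (f g : R -> C) (l m : C) :
  is_RInt_gen (V := CR) f Fa Fb l -> is_RInt_gen (V := CR) g Fa Fb m ->
  is_RInt_gen (V := CR) (fun u => c * f u + d * g u)%C Fa Fb (c * l + d * m)%C.
Proof.
intros Hf Hg.
exact (is_RInt_gen_plus (V := CR) (fun u => c * f u)%C (fun u => d * g u)%C _ _
  (is_RInt_gen_Cmult _ _ c f l Hf) (is_RInt_gen_Cmult _ _ d g m Hg)).
Qed.

Lemma is_half_line_RInt_lin (c d : C) (f g : R -> C) (l m : C) :
  is_half_line_RInt f l -> is_half_line_RInt g m ->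
  is_half_line_RInt (fun u => c * f u + d * g u)%C (c * l + d * m)%C.
Proof. exact (is_RInt_gen_lin (at_right 0) (Rbar_locally p_infty) c d f g l m). Qed.

Lemma is_half_line_RInt_derive (f df : R -> C) (la lb : C) :
  (forall u, 0 < u -> Cderive f u (df u)) -> (forall u, 0 < u -> Ccontinuous df u) ->
  filterlim f (at_right 0) (locally (la : CR)) ->
  filterlim f (Rbar_locally p_infty) (locally (lb : CR)) ->
  is_half_line_RInt df (lb - la)%C.
Proof.
exact (is_RInt_gen_derive (V := CRc) (fun t => 0 < t) (at_right 0) (Rbar_locally p_infty)
  f df la lb ends_half_line).
Qed.

Lemma filterlim_scal_half_line (c : R) : 0 < c ->
  filterlim (fun u => c * u) (at_right 0) (at_right 0) /\
  filterlim (fun u => c * u) (Rbar_locally p_infty) (Rbar_locally p_infty).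
Proof.
intros Hc; split.
- intros P [e He].
  assert (Hd : 0 < e / c) by (apply Rdiv_lt_0_compat; [apply cond_pos | lra]).
  exists (mkposreal _ Hd); intros u Hu Hu0; apply He; [| nra].
  unfold ball in *; cbn in *; unfold AbsRing_ball, abs, minus, plus, opp in *; cbn in *.
  replace (c * u + - 0) with (c * (u + - 0)) by ring.
  rewrite Rabs_mult, (Rabs_pos_eq c) by lra.
  apply (Rmult_lt_compat_l c) in Hu; trivial.
  replace (c * (e / c)) with (pos e) in Hu by (field; lra); lra.
- intros P [M HM]; exists (M / c); intros x Hx; apply HM.
  apply (Rmult_lt_compat_l c) in Hx; trivial;
  replace (c * (M / c)) with M in Hx by (field; lra); lra.
Qed.

Lemma Ccontinuous_gamma (z : C) (c u : R) : 0 < u ->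
  Ccontinuous (fun u => Rcpow u (z - 1) * RtoC (exp (- (c * u))))%C u.
Proof.
intros Hu; eapply Cderive_continuous, Cderive_mult.
- apply (Cderive_Rcpow _ (fun u => u) u 1 Hu), (is_derive_id (K := R_AbsRing)).
- apply (Cderive_RtoC (fun u => exp (- (c * u)))); auto_derive; trivial; reflexivity.
Qed.

Lemma Cmod_gamma (z : C) (c u : R) :
  Cmod (Rcpow u (z - 1) * RtoC (exp (- (c * u))))%C =
  Rpower u (Re z - 1) * exp (- (c * u)).
Proof.
rewrite Cmod_mult, Cmod_Rcpow, Cmod_R, Rabs_pos_eq by apply Rlt_le, exp_pos.
reflexivity.
Qed.

Lemma Gamma_integral_correct (z : C) : 0 < Re z ->
  is_half_line_RInt (fun u => Rcpow u (z - 1) * RtoC (exp (- u)))%C (Gamma_integral z).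
Proof.
intros Hz.
destruct (ex_RInt_gen_gamma_dom (fun u => Rcpow u (z - 1) * RtoC (exp (- (1 * u))))%C
  1 (Re z) 1) as [l Hl]; try lra.
- intros; now apply Ccontinuous_gamma.
- intros; rewrite Cmod_gamma; lra.
- assert (H : is_half_line_RInt (fun u => Rcpow u (z - 1) * RtoC (exp (- u)))%C l).
  { refine (is_half_line_RInt_ext _ _ _ _ _ eq_refl Hl); intros; now rewrite Rmult_1_l. }
  unfold Gamma_integral; now rewrite (Cintegral_half_line _ _ H).
Qed.

Lemma Gamma_integral_scaled (z : C) (c : R) : 0 < Re z -> 0 < c ->
  is_half_line_RInt (fun u => Rcpow u (z - 1) * RtoC (exp (- (c * u))))%C
    (Rcpow c (- z) * Gamma_integral z)%C.
Proof.
intros Hz Hc; destruct (filterlim_scal_half_line c Hc) as [L0 Linf].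
assert (Cf : forall u, 0 < u -> Ccontinuous (fun u => Rcpow u (z - 1) * RtoC (exp (- u)))%C u).
{ intros u Hu; generalize (Ccontinuous_gamma z 1 u Hu); apply continuous_ext.
  intros t; now rewrite Rmult_1_l. }
assert (Dh : forall t, 0 < t -> is_derive (fun u => c * u) t c).
{ intros t _; auto_derive; trivial; ring. }
assert (H := is_RInt_gen_comp (fun t => 0 < t) (fun t => 0 < t) _ _ _ _ _
  (fun u => c * u) (fun _ => c) _ ends_half_line
  (fun t Ht => Rmult_lt_0_compat c t Hc Ht) Cf Dh
  (fun t _ => continuous_const c t) L0 Linf (Gamma_integral_correct z Hz)).
apply (is_RInt_gen_Cmult _ _ (Rcpow c (- z))) in H.
refine (is_half_line_RInt_ext _ _ _ _ _ eq_refl H).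
intros u Hu; cbv beta; rewrite Rcpow_mult_base by trivial.
assert (E : (Rcpow c (- z) * (RtoC c * Rcpow c (z - 1)) = 1)%C).
{ rewrite <- Rcpow_succ, <- Rcpow_plus by trivial.
  replace (- z + z)%C with (RtoC 0) by ring; apply Rcpow_0. }
transitivity ((Rcpow c (- z) * (RtoC c * Rcpow c (z - 1))) *
  (Rcpow u (z - 1) * RtoC (exp (- (c * u)))))%C; [ring | rewrite E; ring].
Qed.

Lemma Gamma_integral_real_scaled (s c : R) : 0 < s -> 0 < c ->
  is_RInt_gen (fun u => Rpower u (s - 1) * exp (- (c * u)))
    (at_right 0) (Rbar_locally p_infty) (Rpower c (- s) * Re (Gamma_integral (RtoC s))).
Proof.
intros Hs Hc.
assert (H := is_RInt_gen_Re _ _ _ _ (Gamma_integral_scaled (RtoC s) c Hs Hc)).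
rewrite <- RtoC_opp, Rcpow_RtoC in H.
replace (Re (RtoC (Rpower c (- s)) * Gamma_integral (RtoC s)))
  with (Rpower c (- s) * Re (Gamma_integral (RtoC s))) in H
  by (unfold Re, Cmult, RtoC; cbn; ring).
refine (is_RInt_gen_ext_on (fun t => 0 < t) _ _ _ _ _ ends_half_line _ H).
intros u Hu; rewrite <- RtoC_minus, Rcpow_RtoC, <- RtoC_mult; reflexivity.
Qed.

(** Keeps the rate [c] explicit: when the rate grows with n, the power c^(-s) produces the decay of
    the error. *)
Lemma half_line_RInt_bound (f : R -> C) (l : C) (M s c : R) : 0 < s -> 0 < c ->
  (forall u, 0 < u -> Cmod (f u) <= M * (Rpower u (s - 1) * exp (- (c * u)))) ->
  is_half_line_RInt f l ->
  Cmod l <= M * (Rpower c (- s) * Re (Gamma_integral (RtoC s))).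
Proof.
intros Hs Hc B Hl.
apply (is_RInt_gen_dom_le (fun t => 0 < t) (at_right 0) (Rbar_locally p_infty) f
  (fun u => M * (Rpower u (s - 1) * exp (- (c * u)))) l); trivial.
- apply ends_half_line.
- apply (is_RInt_gen_scal (V := R_NormedModule)), Gamma_integral_real_scaled; trivial.
Qed.

Lemma filterlim_zero_at_right : filterlim (fun u : R => u) (at_right 0) (locally 0).
Proof. intros P [e He]; exists e; intros u Hu _; auto. Qed.

Lemma filterlim_exp_opp_inf (c : R) : 0 < c ->
  filterlim (fun u => exp (- (c * u))) (Rbar_locally p_infty) (locally 0).
Proof.
intros Hc.
apply (filterlim_comp _ _ _ (fun u => - (c * u)) exp _ (Rbar_locally m_infty));
  [| apply is_lim_exp_m].
intros P [M HM]; exists (- M / c); intros x Hx; apply HM.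
apply (Rmult_lt_compat_l c) in Hx; trivial.
replace (c * (- M / c)) with (- M) in Hx by (field; lra); lra.
Qed.

Lemma Gamma_integral_1 : Gamma_integral 1 = RtoC 1.
Proof.
apply (is_half_line_RInt_inj (fun u => Rcpow u (1 - 1) * RtoC (exp (- u)))%C).
{ apply Gamma_integral_correct; cbn; lra. }
apply (is_half_line_RInt_ext (fun u => RtoC (exp (- u))) _ (RtoC 0 - RtoC (-1))%C).
- intros u _; replace (1 - 1)%C with (RtoC 0) by ring; rewrite Rcpow_0; ring.
- rewrite <- RtoC_minus; f_equal; ring.
- apply (is_half_line_RInt_derive (fun u => RtoC (- exp (- u)))).
  + intros u _; apply (Cderive_RtoC (fun u => - exp (- u))); auto_derive; trivial; ring.
  + intros u _; eapply (Cderive_continuous (fun u => RtoC (exp (- u)))), Cderive_RtoC.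
    auto_derive; trivial; reflexivity.
  + apply (filterlim_comp _ _ _ (fun u => u) (fun u => RtoC (- exp (- u)) : CR) _ (locally 0)).
    { apply filterlim_zero_at_right. }
    assert (L : Ccontinuous (fun u => RtoC (- exp (- u))) 0).
    { eapply Cderive_continuous, (Cderive_RtoC (fun u => - exp (- u))).
      auto_derive; trivial; reflexivity. }
    unfold continuous in L; rewrite Ropp_0, exp_0 in L; exact L.
  + apply (filterlim_C_dom _ _ (fun u => exp (- (1 * u)))).
    * apply filter_forall; intros u.
      rewrite <- RtoC_minus, Cmod_R, Rminus_0_r, Rabs_Ropp, Rabs_pos_eq
        by apply Rlt_le, exp_pos.
      rewrite Rmult_1_l; lra.
    * apply filterlim_exp_opp_inf; lra.
Qed.

(* Integrand of the beta integral after the substitution [t = 1 - exp (- u)]. *)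
Definition beta_exp (z w : C) (u : R) : C :=
  (Rcpow (1 - exp (- u)) (z - 1) * Cexp (- (w * RtoC u)))%C.

Definition Beta (z w : C) : C :=
  Cintegral (beta_exp z w) (at_right 0) (Rbar_locally p_infty).

Lemma exp_opp_lt_1 (u : R) : 0 < u -> 0 < 1 - exp (- u).
Proof.
intros Hu; rewrite <- exp_0 at 1.
assert (exp (- u) < exp 0) by (apply exp_increasing; lra); lra.
Qed.

Lemma one_sub_exp_opp_le (u : R) : 1 - exp (- u) <= u.
Proof. pose proof (exp_ineq1_le (- u)); lra. Qed.

Lemma is_derive_one_sub_exp_opp (u : R) : is_derive (fun u => 1 - exp (- u)) u (exp (- u)).
Proof. auto_derive; trivial; ring. Qed.

Lemma Cderive_Cexp_opp (w : C) (u : R) :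
  Cderive (fun u => Cexp (- (w * RtoC u)))%C u (- w * Cexp (- (w * RtoC u)))%C.
Proof.
eapply Cderive_eq.
- apply (Cderive_Cexp (fun u => - (w * RtoC u)))%C.
  apply (is_derive_ext (V := CR) (fun u => (- w) * RtoC u))%C; [intros; cbn; ring |].
  apply Cderive_scal, (Cderive_RtoC (fun u => u)), (is_derive_id (K := R_AbsRing)).
- cbv beta; unfold one; cbn; ring.
Qed.

Lemma Ccontinuous_beta_exp (z w : C) (u : R) : 0 < u -> Ccontinuous (beta_exp z w) u.
Proof.
intros Hu; eapply Cderive_continuous, Cderive_mult.
- apply (Cderive_Rcpow _ (fun u => 1 - exp (- u))); [now apply exp_opp_lt_1 |].
  apply is_derive_one_sub_exp_opp.
- apply Cderive_Cexp_opp.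
Qed.

(** For u > 0 this is the logarithm of (1 - e^(-u)) / u, the discrepancy between the bases of the
    beta and gamma integrands. *)
Definition delta (u : R) : R := ln (1 - exp (- u)) - ln u.

(** Logarithms of 1 - e^(-u) <= u <= (1 - e^(-u)) (1 + u), the second inequality being 1 + u <= e^u.
    The logarithmic growth serves integrability at infinity; the linear bound derived from it serves
    the asymptotics. *)
Lemma Rabs_delta_le (u : R) : 0 < u -> Rabs (delta u) <= ln (1 + u).
Proof.
intros Hu; pose proof (exp_opp_lt_1 u Hu); pose proof (one_sub_exp_opp_le u).
assert (L : ln (1 - exp (- u)) <= ln u) by (apply ln_le; lra).
assert (ln u <= ln (1 - exp (- u)) + ln (1 + u)).
{ rewrite <- ln_mult by lra; apply ln_le; trivial.
  pose proof (exp_ineq1_le u); pose proof (exp_pos (- u)).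
  assert (exp (- u) * exp u = 1) by (rewrite <- exp_plus, Rplus_opp_l; apply exp_0).
  nra. }
unfold delta; rewrite Rabs_left1; lra.
Qed.

Lemma Rabs_delta_le_id (u : R) : 0 < u -> Rabs (delta u) <= u.
Proof.
intros Hu; eapply Rle_trans; [now apply Rabs_delta_le |].
pose proof (ln_le_sub_1 (1 + u) ltac:(lra)); lra.
Qed.

Lemma beta_exp_factor (z w : C) (u : R) : 0 < u ->
  beta_exp z w u =
  (Rcpow u (z - 1) * Cexp ((z - 1) * RtoC (delta u) - w * RtoC u))%C.
Proof.
intros Hu; unfold beta_exp, Rcpow; rewrite <- !Cexp_plus; f_equal.
unfold delta; rewrite RtoC_minus; ring.
Qed.

Lemma Beta_correct (z w : C) : 0 < Re z -> 0 < Re w ->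
  is_half_line_RInt (beta_exp z w) (Beta z w).
Proof.
intros Hz Hw.
(* The [+ 1] keeps [K] positive when Re z = 1, as [Rpower_le_exp] requires. Half of the decay of the
   integrand absorbs (1 + u)^K <= (K / c)^K e^(c (1 + u)), whence the constant of the domination. *)
set (K := Rabs (Re z - 1) + 1).
assert (HK : 0 < K) by (pose proof (Rabs_pos (Re z - 1)); unfold K; lra).
set (c := Re w / 2); assert (Hc : 0 < c) by (unfold c; lra).
destruct (ex_RInt_gen_gamma_dom (beta_exp z w) (Rpower (K / c) K * exp c) (Re z) c) as [l Hl];
  trivial.
- apply Rmult_le_pos; apply Rlt_le, exp_pos.
- intros; now apply Ccontinuous_beta_exp.
- intros u Hu; rewrite beta_exp_factor by trivial.
  rewrite Cmod_mult, Cmod_Rcpow, Cmod_Cexp.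
  replace (Re (z - 1)%C) with (Re z - 1) by reflexivity.
  replace (Re ((z - 1) * RtoC (delta u) - w * RtoC u)%C)
    with ((Re z - 1) * delta u - Re w * u)
    by (unfold Re, Cminus, Cplus, Copp, Cmult, RtoC; cbn; ring).
  rewrite <- Rmult_assoc, (Rmult_comm _ (Rpower u (Re z - 1))), Rmult_assoc.
  apply Rmult_le_compat_l; [apply Rlt_le, exp_pos |].
  apply Rle_trans with (Rpower (1 + u) K * exp (- (2 * c * u))).
  + unfold Rpower; rewrite <- exp_plus; apply exp_le.
    assert ((Re z - 1) * delta u <= K * ln (1 + u)).
    { eapply Rle_trans; [apply Rle_abs |]; rewrite Rabs_mult.
      apply Rmult_le_compat; try apply Rabs_pos; [unfold K; lra | now apply Rabs_delta_le]. }
    unfold c; lra.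
  + eapply Rle_trans.
    { apply Rmult_le_compat_r; [apply Rlt_le, exp_pos |].
      apply (Rpower_le_exp K c (1 + u)); lra. }
    right; rewrite !Rmult_assoc; f_equal; rewrite <- !exp_plus; f_equal; ring.
- unfold Beta; now rewrite (Cintegral_half_line _ _ Hl).
Qed.

Lemma filterlim_one_sub_exp_opp_0 :
  filterlim (fun u => 1 - exp (- u)) (at_right 0) (at_right 0).
Proof.
intros P [e He]; exists e; intros u Hu Hu0; apply He; [| now apply exp_opp_lt_1].
unfold ball in *; cbn in *; unfold AbsRing_ball, abs, minus, plus, opp in *; cbn in *.
pose proof (exp_opp_lt_1 u Hu0); pose proof (one_sub_exp_opp_le u).
apply Rabs_def2 in Hu; apply Rabs_def1; lra.
Qed.

(** The derivative of (1 - e^(-u))^z e^(-w u) is [(z + w) * beta_exp z (w + 1) u - w * beta_exp z w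
    u], and this primitive vanishes at both ends because Re z and Re w are positive. *)
Lemma Beta_succ (z w : C) : 0 < Re z -> 0 < Re w ->
  ((z + w) * Beta z (w + 1) = w * Beta z w)%C.
Proof.
intros Hz Hw.
assert (Hw1 : 0 < Re (w + 1)%C) by (unfold Re, Cplus, RtoC in *; cbn in *; lra).
set (F := fun u => (Rcpow (1 - exp (- u)) z * Cexp (- (w * RtoC u)))%C).
assert (BF : forall u, 0 < u -> Cmod (F u) = Rpower (1 - exp (- u)) (Re z) * exp (- (Re w * u))).
{ intros u Hu; unfold F; rewrite Cmod_mult, Cmod_Rcpow, Cmod_Cexp; do 2 f_equal.
  unfold Re, Copp, Cmult, RtoC; cbn; ring. }
assert (Q : forall u, 0 < u -> 0 < Rpower (1 - exp (- u)) (Re z) <= 1).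
{ intros u Hu; split; [apply exp_pos |].
  apply Rle_trans with (exp 0); [apply exp_le | rewrite exp_0; lra].
  pose proof (exp_opp_lt_1 u Hu); pose proof (exp_pos (- u)).
  assert (ln (1 - exp (- u)) <= ln 1) by (apply ln_le; lra).
  rewrite ln_1 in *; nra. }
assert (H := is_half_line_RInt_lin (z + w) (- w) _ _ _ _
  (Beta_correct z (w + 1) Hz Hw1) (Beta_correct z w Hz Hw)).
enough (((z + w) * Beta z (w + 1) + - w * Beta z w = 0 - 0)%C) as E.
{ transitivity ((z + w) * Beta z (w + 1) + - w * Beta z w + w * Beta z w)%C; [ring |].
  rewrite E; ring. }
apply (is_half_line_RInt_inj _ _ _ H).
apply (is_half_line_RInt_derive F).
- intros u Hu; unfold F; eapply Cderive_eq.
  { apply Cderive_mult.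
    - apply (Cderive_Rcpow z (fun u => 1 - exp (- u)));
        [now apply exp_opp_lt_1 | apply is_derive_one_sub_exp_opp].
    - apply Cderive_Cexp_opp. }
  cbv beta; unfold beta_exp; rewrite (Rcpow_succ _ z (exp_opp_lt_1 u Hu)).
  replace (- ((w + 1) * RtoC u))%C with (- (w * RtoC u) + RtoC (- u))%C
    by (rewrite RtoC_opp; ring).
  rewrite Cexp_plus, Cexp_RtoC, RtoC_minus; ring.
- intros u Hu; apply (continuous_plus (U := R_UniformSpace) (V := CR)
    (fun u => (z + w) * beta_exp z (w + 1) u)%C (fun u => - w * beta_exp z w u)%C).
  + apply (continuous_comp (U := R_UniformSpace) (V := CR) (W := CR) (beta_exp z (w + 1))
      (fun v => (z + w) * v)%C); [now apply Ccontinuous_beta_exp |].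
    apply linear_cont, is_linear_Cmult.
  + apply (continuous_comp (U := R_UniformSpace) (V := CR) (W := CR) (beta_exp z w)
      (fun v => - w * v)%C); [now apply Ccontinuous_beta_exp |].
    apply linear_cont, is_linear_Cmult.
- apply (filterlim_C_dom _ _ (fun u => Rpower (1 - exp (- u)) (Re z))).
  + exists (mkposreal 1 Rlt_0_1); intros u _ Hu.
    unfold Cminus; rewrite Copp_0, Cplus_0_r, BF by trivial.
    destruct (Q u Hu).
    assert (exp (- (Re w * u)) <= 1) by (rewrite <- exp_0; apply exp_le; nra).
    nra.
  + apply (filterlim_comp _ _ _ (fun u => 1 - exp (- u)) (fun v => Rpower v (Re z)) _ (at_right 0));
      [apply filterlim_one_sub_exp_opp_0 | now apply Rpower_lim_0].
- apply (filterlim_C_dom _ _ (fun u => exp (- (Re w * u)))).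
  + exists 0; intros u Hu.
    unfold Cminus; rewrite Copp_0, Cplus_0_r, BF by trivial.
    destruct (Q u Hu); pose proof (exp_pos (- (Re w * u))); nra.
  + now apply filterlim_exp_opp_inf.
Qed.

(** (1 - e^(-u))^z is a primitive of [z * beta_exp z 1 u] and runs from 0 to 1. *)
Lemma Beta_1_r (z : C) : 0 < Re z -> (z * Beta z 1 = 1)%C.
Proof.
intros Hz.
assert (H1 : 0 < Re 1) by (cbn; lra).
assert (H := is_RInt_gen_Cmult _ _ z _ _ (Beta_correct z 1 Hz H1)).
transitivity (RtoC 1 - RtoC 0)%C; [| ring].
apply (is_half_line_RInt_inj _ _ _ H).
apply (is_half_line_RInt_derive (fun u => Rcpow (1 - exp (- u)) z)).
- intros u Hu; eapply Cderive_eq.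
  { apply (Cderive_Rcpow z (fun u => 1 - exp (- u)));
      [now apply exp_opp_lt_1 | apply is_derive_one_sub_exp_opp]. }
  unfold beta_exp; rewrite <- Cexp_RtoC, RtoC_opp, Cmult_1_l; ring.
- intros u Hu.
  apply (continuous_comp (U := R_UniformSpace) (V := CR) (W := CR) (beta_exp z 1)
      (fun v => z * v)%C); [now apply Ccontinuous_beta_exp |].
  apply linear_cont, is_linear_Cmult.
- apply (filterlim_C_dom _ _ (fun u => Rpower (1 - exp (- u)) (Re z))).
  + apply filter_forall; intros u.
    unfold Cminus; rewrite Copp_0, Cplus_0_r, Cmod_Rcpow; lra.
  + apply (filterlim_comp _ _ _ (fun u => 1 - exp (- u)) (fun v => Rpower v (Re z)) _ (at_right 0));
      [apply filterlim_one_sub_exp_opp_0 | now apply Rpower_lim_0].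
- apply (filterlim_comp _ _ _ (fun u => exp (- u))
    (fun v => Rcpow (1 - v) z : CR) _ (locally 0)).
  { apply filterlim_ext with (2 := filterlim_exp_opp_inf 1 Rlt_0_1).
    intros u; now rewrite Rmult_1_l. }
  assert (L : Ccontinuous (fun v => Rcpow (1 - v) z) 0).
  { eapply Cderive_continuous, (Cderive_Rcpow z (fun v => 1 - v)); [lra |].
    auto_derive; trivial; reflexivity. }
  unfold continuous in L; rewrite Rminus_0_r in L.
  unfold Rcpow in L at 2; rewrite ln_1, Cmult_0_r, Cexp_0 in L; exact L.
Qed.

(** Phrased through real distances so that the limit algebra and squeeze arguments for real
    sequences apply directly. *)
Definition Clim_seq (u : nat -> C) (l : C) : Prop :=
  is_lim_seq (fun n => Cmod (u n - l)) 0.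

Lemma Clim_seq_dom (u : nat -> C) (l : C) (g : nat -> R) :
  eventually (fun n => Cmod (u n - l) <= g n) -> is_lim_seq g 0 -> Clim_seq u l.
Proof.
intros H Hg; apply (is_lim_seq_le_le_loc (fun _ => 0) _ g); trivial.
- revert H; apply filter_imp; intros n H; split; [apply Cmod_ge_0 | exact H].
- apply is_lim_seq_const.
Qed.

Lemma Clim_seq_ext_loc (u v : nat -> C) (l : C) :
  eventually (fun n => u n = v n) -> Clim_seq u l -> Clim_seq v l.
Proof.
intros H; apply is_lim_seq_ext_loc; revert H; apply filter_imp; now intros n ->.
Qed.

Lemma Clim_seq_const (l : C) : Clim_seq (fun _ => l) l.
Proof.
apply (Clim_seq_dom _ _ (fun _ => 0)); [| apply is_lim_seq_const].
exists O; intros n _; unfold Cminus; rewrite Cplus_opp_r, Cmod_0; lra.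
Qed.

Lemma Clim_seq_mult (u v : nat -> C) (l m : C) :
  Clim_seq u l -> Clim_seq v m -> Clim_seq (fun n => u n * v n)%C (l * m)%C.
Proof.
intros Hu Hv.
apply (Clim_seq_dom _ _ (fun n => Cmod (u n - l) * Cmod (v n - m) +
  Cmod l * Cmod (v n - m) + Cmod m * Cmod (u n - l))).
- exists O; intros n _.
  replace (u n * v n - l * m)%C with
    ((u n - l) * (v n - m) + l * (v n - m) + m * (u n - l))%C by ring.
  eapply Rle_trans; [apply Cmod_triangle |]; rewrite Cmod_mult.
  apply Rplus_le_compat_r; eapply Rle_trans; [apply Cmod_triangle |]; rewrite !Cmod_mult; lra.
- replace 0 with (0 * 0 + Cmod l * 0 + Cmod m * 0) by ring.
  apply is_lim_seq_plus'; [apply is_lim_seq_plus' |].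
  + now apply is_lim_seq_mult'.
  + apply is_lim_seq_mult'; [apply is_lim_seq_const | exact Hv].
  + apply is_lim_seq_mult'; [apply is_lim_seq_const | exact Hu].
Qed.

Lemma Clim_seq_unique (u : nat -> C) (l m : C) : Clim_seq u l -> Clim_seq u m -> l = m.
Proof.
intros Hl Hm.
assert (H : is_lim_seq (fun _ => Cmod (l - m)) 0).
{ apply (is_lim_seq_le_le (fun _ => 0) _ (fun n => Cmod (u n - l) + Cmod (u n - m))).
  - intros n; split; [apply Cmod_ge_0 |].
    rewrite <- (Cmod_opp (u n - l)).
    replace (l - m)%C with (- (u n - l) + (u n - m))%C by ring; apply Cmod_triangle.
  - apply is_lim_seq_const.
  - replace 0 with (0 + 0) by ring; now apply is_lim_seq_plus'. }
apply is_lim_seq_unique in H; rewrite Lim_seq_const in H; injection H as H.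
apply Cmod_eq_0 in H; transitivity (l - m + m)%C; [ring | rewrite H; ring].
Qed.

Lemma is_lim_seq_INR_eventually (K : R) : eventually (fun n => K < INR n).
Proof. apply (is_lim_seq_INR (fun x => K < x)); now exists K. Qed.

Lemma is_lim_seq_div_INR (c : R) : is_lim_seq (fun n => c / INR n) 0.
Proof.
replace 0 with (c * 0) by ring.
apply (is_lim_seq_mult' (fun _ => c) (fun n => / INR n)); [apply is_lim_seq_const |].
apply (is_lim_seq_inv INR p_infty); [apply is_lim_seq_INR | easy].
Qed.

Lemma Re_plus_INR (z : C) (n : nat) : Re (z + RtoC (INR n)) = Re z + INR n.
Proof. reflexivity. Qed.

(** The gamma integrand dominates itself, so 0 <= |Gamma(s)| <= Re Gamma(s). *)
Lemma Gamma_integral_real_ge_0 (s : R) : 0 < s -> 0 <= Re (Gamma_integral (RtoC s)).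
Proof.
intros Hs.
pose proof (Gamma_integral_scaled (RtoC s) 1 Hs Rlt_0_1) as H.
apply (half_line_RInt_bound _ _ 1 s 1 Hs Rlt_0_1) in H.
- unfold Rpower in H; rewrite ln_1, Rmult_0_r, exp_0 in H.
  eapply Rle_trans; [apply Cmod_ge_0 |]; eapply Rle_trans; [exact H | lra].
- intros u Hu; rewrite Cmod_gamma; cbn; lra.
Qed.

(* Both integrands are [u^(z-1) e^(-n u)] up to a factor [exp zeta] with
   [|zeta| <= K u], and the mass concentrates near [u = 0]. *)
Lemma Beta_asymptotics (z w : C) : 0 < Re z -> 0 < Re w ->
  Clim_seq (fun n => Rcpow (INR n) z * Beta z (w + RtoC (INR n)))%C (Gamma_integral z).
Proof.
intros Hz Hw.
set (K := Cmod (z - 1) + Cmod w).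
assert (HK : 0 <= K) by (pose proof (Cmod_ge_0 (z - 1)); pose proof (Cmod_ge_0 w); unfold K; lra).
(* The factor e^zeta - 1 is at most K u e^(K u) in modulus: one more power of u, hence the exponent
   Re z + 1, and a loss of [K] in the rate n. *)
set (s := Re z + 1); assert (Hs : 0 < s) by (unfold s; lra).
set (G := Re (Gamma_integral (RtoC s))).
assert (HG : 0 <= G) by now apply Gamma_integral_real_ge_0.
apply (Clim_seq_dom _ _ (fun n => K * Rpower 2 s * G / INR n)); [| apply is_lim_seq_div_INR].
(* For n > 2 K + 1, n - K is at least n / 2, so (n - K)^(-s) <= 2^s n^(-s); against the prefactor of
   modulus n^(Re z) this leaves 1 / n. *)
generalize (is_lim_seq_INR_eventually (2 * K + 1)); apply filter_imp.
intros n; set (m := INR n); intros Hm.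
assert (Hwm : 0 < Re (w + RtoC m)) by (cbn; unfold Re in Hw; lra).
assert (H := is_half_line_RInt_lin 1 (-1) _ _ _ _ (Beta_correct z (w + RtoC m) Hz Hwm)
  (Gamma_integral_scaled z m Hz ltac:(lra))).
apply (half_line_RInt_bound _ _ K s (m - K) Hs ltac:(lra)) in H.
- fold G in H.
  replace (Rcpow m z * Beta z (w + RtoC m) - Gamma_integral z)%C with
    (Rcpow m z * (1 * Beta z (w + RtoC m) + -1 * (Rcpow m (- z) * Gamma_integral z)))%C.
  2: { rewrite Rcpow_opp; field; apply Rcpow_neq_0. }
  rewrite Cmod_mult, Cmod_Rcpow.
  assert (P : 0 < Rpower m (Re z)) by apply exp_pos.
  eapply Rle_trans; [apply Rmult_le_compat_l; [lra | exact H] |].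
  assert (B : Rpower (m - K) (- s) <= Rpower 2 s * Rpower m (- s)).
  { unfold Rpower; rewrite <- exp_plus; apply exp_le.
    assert (L : ln m <= ln 2 + ln (m - K)) by (rewrite <- ln_mult by lra; apply ln_le; lra).
    nra. }
  assert (E : Rpower m (Re z) * Rpower m (- s) = / m).
  { rewrite <- Rpower_plus; unfold s; replace (Re z + - (Re z + 1)) with (- (1)) by ring.
    rewrite Rpower_Ropp, Rpower_1; lra. }
  unfold Rdiv; rewrite <- E.
  replace (K * Rpower 2 s * G * (Rpower m (Re z) * Rpower m (- s))) with
    (Rpower m (Re z) * (K * (Rpower 2 s * Rpower m (- s) * G))) by ring.
  apply Rmult_le_compat_l; [lra |]; apply Rmult_le_compat_l; trivial.
  now apply Rmult_le_compat_r.
- intros u Hu; rewrite beta_exp_factor by trivial.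
  set (zeta := ((z - 1) * RtoC (delta u) - w * RtoC u)%C).
  replace ((z - 1) * RtoC (delta u) - (w + RtoC m) * RtoC u)%C
    with (zeta + RtoC (- (m * u)))%C by (unfold zeta; rewrite RtoC_opp, RtoC_mult; ring).
  rewrite Cexp_plus, Cexp_RtoC.
  replace (1 * _ + _)%C with
    (Rcpow u (z - 1) * RtoC (exp (- (m * u))) * (Cexp zeta - 1))%C by ring.
  rewrite Cmod_mult, Cmod_gamma.
  assert (Z : Cmod zeta <= K * u).
  { unfold zeta, Cminus at 1; eapply Rle_trans; [apply Cmod_triangle |].
    rewrite Cmod_opp, !Cmod_mult, !Cmod_R, (Rabs_pos_eq u) by lra.
    pose proof (Rabs_delta_le_id u Hu); pose proof (Cmod_ge_0 (z - 1)).
    unfold K; rewrite Rmult_plus_distr_r; apply Rplus_le_compat_r, Rmult_le_compat_l; trivial. }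
  assert (Z' : Cmod (Cexp zeta - 1) <= K * u * exp (K * u)).
  { eapply Rle_trans; [apply Cmod_Cexp_sub_1 |].
    apply Rmult_le_compat; [apply Cmod_ge_0 | apply Rlt_le, exp_pos | exact Z | now apply exp_le]. }
  eapply Rle_trans.
  { apply Rmult_le_compat_l; [| exact Z'].
    apply Rmult_le_pos; apply Rlt_le, exp_pos. }
  right; replace (s - 1) with (Re z - 1 + 1) by (unfold s; ring).
  rewrite Rpower_plus, (Rpower_1 u) by trivial.
  replace (- ((m - K) * u)) with (- (m * u) + K * u) by ring; rewrite exp_plus; ring.
Qed.

Lemma Re_pos_neq_0 (z : C) : 0 < Re z -> z <> 0.
Proof. intros H ->; cbn in H; lra. Qed.

Lemma poch_neq_0 (z : C) (n : nat) : 0 < Re z -> poch z n <> 0.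
Proof.
intros Hz; induction n as [| n IH]; cbn [poch].
- intros E; apply RtoC_inj in E; lra.
- apply Cmult_neq_0; [exact IH |].
  apply Re_pos_neq_0; rewrite Re_plus_INR; pose proof (pos_INR n); lra.
Qed.

Lemma Beta_add (z w : C) (n : nat) : 0 < Re z -> 0 < Re w ->
  (poch (z + w) n * Beta z (w + RtoC (INR n)) = poch w n * Beta z w)%C.
Proof.
intros Hz Hw; induction n as [| n IH].
- cbn [poch]; rewrite Cplus_0_r; trivial.
- cbn [poch]; rewrite S_INR, RtoC_plus.
  pose proof (Beta_succ z (w + RtoC (INR n)) Hz) as E.
  rewrite Re_plus_INR in E; specialize (E ltac:(pose proof (pos_INR n); lra)).
  transitivity (poch (z + w) n * ((z + (w + RtoC (INR n))) *
    Beta z (w + RtoC (INR n) + 1)))%C.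
  { rewrite (Cplus_assoc w (RtoC (INR n))); ring. }
  rewrite E; transitivity ((w + RtoC (INR n)) *
    (poch (z + w) n * Beta z (w + RtoC (INR n))))%C; [ring | rewrite IH; ring].
Qed.

Lemma poch_1 (n : nat) : poch 1 n = RtoC (INR (fact n)).
Proof.
induction n as [| n IH]; trivial; cbn [poch]; rewrite IH.
rewrite fact_simpl, mult_INR, S_INR, RtoC_mult, RtoC_plus; ring.
Qed.

Lemma poch_succ_l (z : C) (n : nat) : poch z (S n) = (z * poch (z + 1) n)%C.
Proof.
induction n as [| n IH]; [cbn; ring |].
change (poch z (S (S n))) with (poch z (S n) * (z + RtoC (INR (S n))))%C.
rewrite IH, S_INR, RtoC_plus; cbn [poch]; ring.
Qed.

(** Euler's limit formula is the case w = 1 of the asymptotics, since B(z, n + 1) = n! / (z)_(n+1)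
    by the functional equation. *)
Lemma Gamma_integral_euler (z : C) : 0 < Re z ->
  Clim_seq (fun n => Rcpow (INR n) z * RtoC (INR (fact n)) / poch z (S n))%C (Gamma_integral z).
Proof.
intros Hz; assert (H1 : 0 < Re 1) by (cbn; lra).
eapply Clim_seq_ext_loc; [| exact (Beta_asymptotics z 1 Hz H1)].
exists O; intros n _.
assert (Hz1 : 0 < Re (z + 1)) by (cbn; unfold Re in Hz; lra).
pose proof (Beta_add z 1 n Hz H1) as E; rewrite poch_1 in E.
pose proof (Beta_1_r z Hz) as E1.
pose proof (poch_neq_0 (z + 1) n Hz1); pose proof (Re_pos_neq_0 z Hz).
rewrite poch_succ_l.
transitivity (Rcpow (INR n) z * (poch (z + 1) n * Beta z (1 + RtoC (INR n))) / poch (z + 1) n)%C;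
  [field; trivial |].
rewrite E; replace (RtoC (INR (fact n)) * Beta z 1)%C
  with (RtoC (INR (fact n)) * (z * Beta z 1) / z)%C by (field; trivial).
rewrite E1; field; now split.
Qed.

(** Compensates the index mismatch between Euler's formula, with Pochhammer symbols of length n + 1,
    and [Beta_add], with length n. *)
Lemma Clim_seq_ratio (v w : C) : 0 < Re v ->
  Clim_seq (fun n => (w + RtoC (INR n)) / (v + RtoC (INR n)))%C 1.
Proof.
intros Hv; apply (Clim_seq_dom _ _ (fun n => Cmod (w - v) / INR n)); [| apply is_lim_seq_div_INR].
exists 1%nat; intros n Hn; apply lt_0_INR in Hn.
assert (Hvn : INR n <= Cmod (v + RtoC (INR n))).
{ eapply Rle_trans; [| apply Re_le_Cmod]; rewrite Re_plus_INR; lra. }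
assert (N0 : (v + RtoC (INR n))%C <> 0) by (apply Cmod_gt_0; lra).
replace ((w + RtoC (INR n)) / (v + RtoC (INR n)) - 1)%C with ((w - v) / (v + RtoC (INR n)))%C
  by (field; trivial).
rewrite Cmod_div by trivial; apply Rmult_le_compat_l; [apply Cmod_ge_0 |].
apply Rinv_le_contravar; lra.
Qed.

(** The limit of B(z, w) n^(z+w) n! / (z + w)_(n+1) is computed twice. Euler's formula gives the
    left-hand side. Writing B(z, w) = (z + w)_n B(z, w + n) / (w)_n factors the sequence into n^z
    B(z, w + n), Euler's sequence for w and a ratio tending to 1, which gives the right-hand
    side. *)
Lemma Beta_Gamma (z w : C) : 0 < Re z -> 0 < Re w ->
  (Beta z w * Gamma_integral (z + w) = Gamma_integral z * Gamma_integral w)%C.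
Proof.
intros Hz Hw; assert (Hzw : 0 < Re (z + w)) by (cbn; unfold Re in *; lra).
apply (Clim_seq_unique (fun n => Beta z w *
  (Rcpow (INR n) (z + w) * RtoC (INR (fact n)) / poch (z + w) (S n)))%C).
- apply Clim_seq_mult; [apply Clim_seq_const | now apply Gamma_integral_euler].
- assert (L := Clim_seq_mult _ _ _ _ (Clim_seq_mult _ _ _ _ (Beta_asymptotics z w Hz Hw)
    (Gamma_integral_euler w Hw)) (Clim_seq_ratio (z + w) w Hzw)).
  rewrite Cmult_1_r in L; revert L; apply Clim_seq_ext_loc; exists O; intros n _.
  cbn [poch]; pose proof (Beta_add z w n Hz Hw) as E.
  pose proof (poch_neq_0 w n Hw); pose proof (poch_neq_0 (z + w) n Hzw).
  assert (0 <= INR n) by apply pos_INR.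
  assert (w + RtoC (INR n) <> 0)%C by (apply Re_pos_neq_0; rewrite Re_plus_INR; lra).
  assert (z + w + RtoC (INR n) <> 0)%C by (apply Re_pos_neq_0; rewrite Re_plus_INR; lra).
  rewrite Rcpow_plus.
  replace (Beta z w) with (poch (z + w) n * Beta z (w + RtoC (INR n)) / poch w n)%C
    by (rewrite E; field; trivial).
  field; repeat split; trivial.
Qed.

Lemma Gamma_integral_succ (z : C) : 0 < Re z -> Gamma_integral (z + 1) = (z * Gamma_integral z)%C.
Proof.
intros Hz; assert (H1 : 0 < Re 1) by (cbn; lra).
pose proof (Beta_Gamma z 1 Hz H1) as E; rewrite Gamma_integral_1, Cmult_1_r in E.
rewrite <- E, Cmult_assoc, Beta_1_r by trivial; ring.
Qed.

(** Quantitative continuity at 1, for the nonvanishing argument. The difference has integrand (u^e -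
    1) e^(-u), which is bounded by 8 |e| u^(-1/2) e^(-u/2); the last factor of the statement is the
    integral of u^(-1/2) e^(-u/2). *)
Lemma Gamma_integral_near_1 (e : C) : Cmod e <= / 4 ->
  Cmod (Gamma_integral (1 + e) - 1) <=
  8 * Cmod e * (Rpower (/ 2) (- / 2) * Re (Gamma_integral (RtoC (/ 2)))).
Proof.
intros He; pose proof (Re_le_Cmod (- e)) as Hre; rewrite Cmod_opp in Hre.
replace (Re (- e)) with (- Re e) in Hre by reflexivity.
assert (H1e : 0 < Re (1 + e)) by (cbn; unfold Re in *; lra).
assert (H1 : 0 < Re 1) by (cbn; lra).
assert (H := is_half_line_RInt_lin 1 (-1) _ _ _ _ (Gamma_integral_correct _ H1e)
  (Gamma_integral_correct 1 H1)).
rewrite Gamma_integral_1 in H.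
replace (Gamma_integral (1 + e) - 1)%C with (1 * Gamma_integral (1 + e) + -1 * 1)%C by ring.
assert (P2 : 0 < / 2) by lra.
refine (half_line_RInt_bound _ _ _ (/ 2) (/ 2) P2 P2 _ H).
intros u Hu; replace (1 + e - 1)%C with e by ring; replace (1 - 1)%C with (RtoC 0) by ring.
rewrite Rcpow_0.
replace (1 * _ + _)%C with ((Rcpow u e - 1) * RtoC (exp (- u)))%C by ring.
rewrite Cmod_mult, Cmod_R, (Rabs_pos_eq (exp _)) by apply Rlt_le, exp_pos.
set (x := Rabs (ln u)); assert (Hx : 0 <= x) by apply Rabs_pos.
(* |e| <= 1/4 bounds the exponential factor by e^(x/4), and x <= 4 e^(x/4) the linear one. The 8 of
   the statement is this 4 times the 2 in [1 + u <= 2 * exp (u / 2)]. *)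
assert (B : Cmod (Rcpow u e - 1) <= Cmod e * (4 * exp (x / 2))).
{ unfold Rcpow; eapply Rle_trans; [apply Cmod_Cexp_sub_1 |].
  rewrite Cmod_mult, Cmod_R; fold x; rewrite Rmult_assoc.
  apply Rmult_le_compat_l; [apply Cmod_ge_0 |].
  replace (x / 2) with (x / 4 + x / 4) by field; rewrite exp_plus, <- Rmult_assoc.
  pose proof (exp_ineq1_le (x / 4)).
  apply Rmult_le_compat; [lra | apply Rlt_le, exp_pos | lra | apply exp_le; nra]. }
(* According to the sign of ln u, the left side is u^(-1/2) or u^(1/2) = u^(-1/2) u; the factor 1 +
   u covers both. *)
assert (X : exp (x / 2) <= Rpower u (/ 2 - 1) * (1 + u)).
{ unfold x, Rabs; destruct (Rcase_abs (ln u)).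
  - apply Rle_trans with (Rpower u (/ 2 - 1) * 1);
      [| apply Rmult_le_compat_l; [apply Rlt_le, exp_pos | lra]].
    unfold Rpower; rewrite Rmult_1_r; apply exp_le; lra.
  - apply Rle_trans with (Rpower u (/ 2 - 1) * Rpower u 1);
      [| apply Rmult_le_compat_l; [apply Rlt_le, exp_pos | rewrite Rpower_1; lra]].
    rewrite <- Rpower_plus; unfold Rpower; apply exp_le; lra. }
assert (Y : 1 + u <= 2 * exp (u / 2)) by (pose proof (exp_ineq1_le (u / 2)); lra).
assert (E : exp (u / 2) * exp (- u) = exp (- (/ 2 * u))).
{ rewrite <- exp_plus; f_equal; field. }
rewrite <- E.
assert (P : 0 < Rpower u (/ 2 - 1)) by apply exp_pos.
apply Rle_trans with (Cmod e * (4 * (Rpower u (/ 2 - 1) * (2 * exp (u / 2)))) * exp (- u)).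
- apply Rmult_le_compat_r; [apply Rlt_le, exp_pos |].
  eapply Rle_trans; [exact B |].
  apply Rmult_le_compat_l; [apply Cmod_ge_0 |].
  apply Rmult_le_compat_l; [lra |].
  eapply Rle_trans; [exact X | apply Rmult_le_compat_l; lra].
- right; ring.
Qed.

(* A zero [z] would give zeros [z / 2^k] by the beta identity, contradicting
   [e * Gamma e = Gamma (1 + e) --> 1] as [e --> 0]. *)
Lemma Gamma_integral_neq_0 (z : C) : 0 < Re z -> Gamma_integral z <> 0.
Proof.
intros Hz E.
assert (Hk : forall k, 0 < Re (z * RtoC (/ 2 ^ k)) /\ Gamma_integral (z * RtoC (/ 2 ^ k)) = 0).
{ intros k; induction k as [| k [IH1 IH2]].
  - rewrite pow_O, Rinv_1, Cmult_1_r; now split.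
  - set (h := (z * RtoC (/ 2 ^ S k))%C).
    assert (D : (z * RtoC (/ 2 ^ k))%C = (h + h)%C).
    { unfold h; rewrite <- Cmult_plus_distr_l, <- RtoC_plus; do 2 f_equal.
      cbn; field; apply pow_nonzero; lra. }
    assert (Hh : 0 < Re h).
    { unfold h; rewrite Re_mult_RtoC; apply Rmult_lt_0_compat; trivial.
      apply Rinv_0_lt_compat, pow_lt; lra. }
    split; trivial.
    pose proof (Beta_Gamma h h Hh Hh) as B; rewrite <- D, IH2, Cmult_0_r in B.
    destruct (Ceq_dec (Gamma_integral h) 0) as [|N]; trivial.
    exfalso; symmetry in B; now apply (Cmult_neq_0 _ _ N N). }
set (M := Rpower (/ 2) (- / 2) * Re (Gamma_integral (RtoC (/ 2)))).
assert (HM : 0 <= M).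
{ apply Rmult_le_pos; [apply Rlt_le, exp_pos | apply Gamma_integral_real_ge_0; lra]. }
assert (L : is_lim_seq (fun k => Cmod z * (/ 2) ^ k) 0).
{ replace 0 with (Cmod z * 0) by ring.
  apply is_lim_seq_mult'; [apply is_lim_seq_const | apply is_lim_seq_geom].
  rewrite Rabs_pos_eq; lra. }
(* For |e| < 1 / (8 M + 1) the bound 8 |e| M is below 1, whereas a zero at e makes Gamma(1 + e) - 1
   equal to -1; 1/4 is the range of [Gamma_integral_near_1]. *)
assert (Hd : 0 < Rmin (/ 4) (/ (8 * M + 1))).
{ apply Rmin_pos; [lra | apply Rinv_0_lt_compat; lra]. }
destruct (proj1 (filterlim_locally _ _) L (mkposreal _ Hd)) as [k Bk].
specialize (Bk k (Nat.le_refl k)); unfold ball in Bk; cbn in Bk.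
unfold AbsRing_ball, abs, minus, plus, opp in Bk; cbn in Bk; apply Rabs_def2 in Bk.
destruct (Hk k) as [H1 H2]; set (e := (z * RtoC (/ 2 ^ k))%C) in *.
assert (He : Cmod e = Cmod z * (/ 2) ^ k).
{ unfold e; rewrite Cmod_mult, Cmod_R, <- pow_inv, Rabs_pos_eq; trivial.
  apply pow_le; lra. }
pose proof (Rmin_l (/ 4) (/ (8 * M + 1))); pose proof (Rmin_r (/ 4) (/ (8 * M + 1))).
pose proof (Gamma_integral_near_1 e ltac:(lra)) as N.
rewrite Cplus_comm, (Gamma_integral_succ e H1), H2, Cmult_0_r in N; fold M in N.
replace (0 - 1)%C with (- (1))%C in N by ring; rewrite Cmod_opp, Cmod_1 in N.
pose proof (Cmod_ge_0 e).
assert (/ (8 * M + 1) * (8 * M + 1) = 1) by (field; lra).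
assert (Cmod e * (8 * M + 1) < / (8 * M + 1) * (8 * M + 1)) by (apply Rmult_lt_compat_r; lra).
nra.
Qed.

(** * Continuation of Gamma to the left half-plane *)

Lemma Gamma_shift_pos (z : C) : 0 < Re z -> Gamma_shift z = O.
Proof.
intros Hz; unfold Gamma_shift; destruct (archimed (- Re z)) as [_ H].
assert (up (- Re z) < 1)%Z by (apply lt_IZR; lra).
destruct (up (- Re z)); trivial; lia.
Qed.

(** Raising z by 1 lowers the shift by 1, so Gamma(z) and Gamma(z + 1) refer to the same integral,
    and for Re z <= 0 the functional equation reduces to Pochhammer algebra. *)
Lemma Gamma_shift_succ (z : C) : Re z <= 0 -> Gamma_shift z = S (Gamma_shift (z + 1)).
Proof.
intros Hz; unfold Gamma_shift; destruct (archimed (- Re z)) as [H1 H2].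
assert (H : (up (- Re z) - 1)%Z = up (- Re (z + 1))).
{ replace (Re (z + 1)) with (Re z + 1) by reflexivity.
  apply tech_up; rewrite minus_IZR; lra. }
rewrite <- H.
assert (0 < up (- Re z))%Z by (apply lt_IZR; lra).
lia.
Qed.

Lemma Gamma_pos (z : C) : 0 < Re z -> Gamma z = Gamma_integral z.
Proof.
intros Hz; unfold Gamma; rewrite Gamma_shift_pos by trivial; cbn [poch INR].
rewrite Cplus_0_r; field; intros E; apply RtoC_inj in E; lra.
Qed.

Lemma Gamma_neq_0 (z : C) : 0 < Re z -> Gamma z <> 0.
Proof. intros Hz; rewrite Gamma_pos by trivial; now apply Gamma_integral_neq_0. Qed.

Lemma nonpos_int_0 : nonpos_int 0.
Proof. exists O; f_equal; cbn; ring. Qed.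

Lemma poch_neq_0_gen (z : C) (n : nat) : ~ nonpos_int z -> poch z n <> 0.
Proof.
intros Hz; induction n as [| n IH]; cbn [poch].
- intros E; apply RtoC_inj in E; lra.
- apply Cmult_neq_0; [exact IH |].
  intros E; apply Hz; exists n; rewrite RtoC_opp.
  transitivity (z + RtoC (INR n) - RtoC (INR n))%C; [ring | rewrite E; ring].
Qed.

Lemma nonpos_int_add (z : C) (n : nat) : nonpos_int (z + RtoC (INR n)) -> nonpos_int z.
Proof.
intros [k E]; exists (k + n)%nat; rewrite plus_INR.
transitivity (z + RtoC (INR n) - RtoC (INR n))%C; [ring |].
rewrite E, <- RtoC_minus; f_equal; ring.
Qed.

Lemma Gamma_succ (z : C) : ~ nonpos_int z -> Gamma (z + 1) = (z * Gamma z)%C.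
Proof.
intros Hz; destruct (Rle_lt_dec (Re z) 0) as [H | H].
- assert (z <> 0) by (intros ->; apply Hz, nonpos_int_0).
  unfold Gamma; rewrite (Gamma_shift_succ z H), poch_succ_l.
  set (k := Gamma_shift (z + 1)).
  replace (z + RtoC (INR (S k)))%C with (z + 1 + RtoC (INR k))%C
    by (rewrite S_INR, RtoC_plus; ring).
  assert (poch (z + 1) k <> 0).
  { apply poch_neq_0_gen; intros N; apply Hz, (nonpos_int_add z 1), N. }
  field; now split.
- rewrite (Gamma_pos z H), Gamma_pos by (cbn; unfold Re in H; lra); now apply Gamma_integral_succ.
Qed.

Lemma Gamma_add (z : C) (n : nat) : ~ nonpos_int z ->
  Gamma (z + RtoC (INR n)) = (poch z n * Gamma z)%C.
Proof.
intros Hz; induction n as [| n IH].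
- cbn [poch INR]; rewrite Cplus_0_r; ring.
- replace (z + RtoC (INR (S n)))%C with (z + RtoC (INR n) + 1)%C
    by (rewrite S_INR, RtoC_plus; ring).
  rewrite Gamma_succ by (intros N; now apply Hz, (nonpos_int_add z n)).
  rewrite IH; cbn [poch]; ring.
Qed.

Lemma Re_pos_not_nonpos_int (z : C) : 0 < Re z -> ~ nonpos_int z.
Proof. intros Hz [k ->]; cbn in Hz; pose proof (pos_INR k); lra. Qed.

(** * The beta integral on a segment *)

Lemma is_RInt_gen_ext_C (D : R -> Prop) Fa Fb {FFa : Filter Fa} {FFb : Filter Fb}
  (f g : R -> C) (l : C) :
  ends D Fa Fb -> (forall x, D x -> f x = g x :> C) ->
  is_RInt_gen (V := CR) f Fa Fb l -> is_RInt_gen (V := CR) g Fa Fb l.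
Proof. exact (is_RInt_gen_ext_on (V := CR) D Fa Fb f g l). Qed.

(* [t = y - (y - a) exp (- u)] is the substitution [u = seg_log a y t]. *)
Definition seg_log (a y t : R) : R := ln (y - a) - ln (y - t).

Lemma seg_log_pos (a y t : R) : a < t < y -> 0 < seg_log a y t.
Proof.
intros Ht; unfold seg_log.
assert (ln (y - t) < ln (y - a)) by (apply ln_increasing; lra); lra.
Qed.

Lemma exp_opp_seg_log (a y t : R) : a < t < y ->
  exp (- seg_log a y t) = (y - t) / (y - a).
Proof.
intros Ht; unfold seg_log, Rdiv.
replace (- (ln (y - a) - ln (y - t))) with (ln (y - t) + - ln (y - a)) by ring.
rewrite exp_plus, exp_Ropp, !exp_ln; trivial; lra.
Qed.

(** Pull-back of [Beta_correct] along [seg_log]: 1 - e^(-u) and e^(-u) become (t - a) / (y - a) and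
    (y - t) / (y - a), and the Jacobian 1 / (y - t) lowers the exponent w to w - 1. The prefactor
    collects the powers of y - a. *)
Lemma Beta_segment (a y : R) (z w : C) : a < y -> 0 < Re z -> 0 < Re w ->
  is_RInt_gen (V := CR) (fun t => Rcpow (t - a) (z - 1) * Rcpow (y - t) (w - 1))%C
    (at_right a) (at_left y) (Rcpow (y - a) (z + w - 1) * Beta z w)%C.
Proof.
intros Hay Hz Hw; set (L := y - a); set (h := seg_log a y); assert (HL : 0 < L) by (unfold L; lra).
assert (L1 : filterlim h (at_right a) (at_right 0)).
{ intros P HP; unfold filtermap.
  assert (Cont : continuous h a).
  { apply (ex_derive_continuous (V := R_NormedModule)); unfold h, seg_log; auto_derive; lra. }
  destruct HP as [e He].
  assert (Ce := proj1 (filterlim_locally _ _) Cont e); cbv beta in Ce.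
  replace (h a) with 0 in Ce by (unfold h, seg_log; ring).
  destruct Ce as [d Hd].
  assert (Hm : 0 < Rmin d L) by (apply Rmin_pos; [apply cond_pos | exact HL]).
  exists (mkposreal _ Hm); intros t Ht Hat.
  pose proof (Rmin_l d L); pose proof (Rmin_r d L).
  assert (Ht' : t - a < Rmin d L).
  { unfold ball in Ht; cbn in Ht; unfold AbsRing_ball, abs, minus, plus, opp in Ht; cbn in Ht.
    apply Rabs_def2 in Ht; lra. }
  apply He.
  - apply Hd; unfold ball; cbn; unfold AbsRing_ball, abs, minus, plus, opp; cbn.
    apply Rabs_def1; lra.
  - apply seg_log_pos; unfold L in *; lra. }
assert (L2 : filterlim h (at_left y) (Rbar_locally p_infty)).
{ apply (filterlim_comp _ _ _ (fun t => ln (y - t)) (fun v => ln L - v) _ (Rbar_locally m_infty)).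
  - apply (filterlim_comp _ _ _ (fun t => y - t) ln _ (at_right 0)); [| apply is_lim_ln_0].
    intros P [e He]; exists e; intros t Ht Hty; apply He; [| lra].
    unfold ball in *; cbn in *; unfold AbsRing_ball, abs, minus, plus, opp in *; cbn in *.
    apply Rabs_def2 in Ht; apply Rabs_def1; lra.
  - intros P [M HM]; exists (ln L - M); intros v Hv; apply HM; lra. }
assert (Dh : forall t, a < t < y -> is_derive h t (/ (y - t))).
{ intros t Ht; unfold h, seg_log; auto_derive; [lra | field; lra]. }
assert (Ch : forall t, a < t < y -> continuous (fun t => / (y - t)) t).
{ intros t Ht; apply (ex_derive_continuous (V := R_NormedModule)); auto_derive; lra. }
assert (H := is_RInt_gen_comp (fun t => a < t < y) (fun t => 0 < t) _ _ _ _
  (beta_exp z w) h (fun t => / (y - t)) _ (ends_segment a y Hay) (seg_log_pos a y)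
  (Ccontinuous_beta_exp z w) Dh Ch L1 L2 (Beta_correct z w Hz Hw)).
apply (is_RInt_gen_Cmult _ _ (Rcpow L (z + w - 1))) in H.
refine (is_RInt_gen_ext_C _ _ _ _ _ _ (ends_segment a y Hay) _ H).
intros t Ht; unfold beta_exp; unfold h; rewrite exp_opp_seg_log by trivial; fold L.
replace (1 - (y - t) / L) with ((t - a) / L) by (unfold L; field; lra).
replace (Cexp (- (w * RtoC (seg_log a y t)))) with (Rcpow ((y - t) / L) w).
2: { unfold Rcpow, L; f_equal; rewrite <- exp_opp_seg_log, ln_exp, RtoC_opp by trivial; ring. }
assert (Ha : 0 < (t - a) / L) by (apply Rdiv_lt_0_compat; lra).
assert (Hy : 0 < (y - t) / L) by (apply Rdiv_lt_0_compat; lra).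
replace (t - a) with (L * ((t - a) / L)) at 2 by (field; lra).
replace (y - t) with (L * ((y - t) / L)) at 3 by (field; lra).
rewrite !Rcpow_mult_base, (Rcpow_succ ((y - t) / L) w) by trivial.
replace (z + w - 1)%C with (z - 1 + (w - 1) + 1)%C by ring.
rewrite !Rcpow_plus, Rcpow_1 by trivial.
replace (RtoC (/ (y - t))) with (/ (RtoC L * RtoC ((y - t) / L)))%C.
2: { rewrite <- RtoC_mult, <- RtoC_inv; [f_equal; field; lra |].
  apply Rmult_integral_contrapositive; lra. }
field; split; intros E; apply RtoC_inj in E; lra.
Qed.

(** * Complex power series *)

Definition Csum (u : nat -> C) (n : nat) : C := sum_n (G := CR) u n.

Lemma Csum_0 (u : nat -> C) : Csum u 0 = u O.
Proof. apply (sum_O (G := CR)). Qed.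

Lemma Csum_S (u : nat -> C) (n : nat) : Csum u (S n) = (Csum u n + u (S n))%C.
Proof. apply (sum_Sn (G := CR)). Qed.

Lemma Csum_lin (a : C) (u v : nat -> C) (n : nat) :
  Csum (fun k => a * u k + v k)%C n = (a * Csum u n + Csum v n)%C.
Proof.
induction n as [| n IH]; [now rewrite !Csum_0 | rewrite !Csum_S, IH; ring].
Qed.

Lemma Csum_ext (u v : nat -> C) (n : nat) : (forall k, u k = v k) -> Csum u n = Csum v n.
Proof. intros H; apply (sum_n_ext (G := CR)), H. Qed.

Lemma Re_Csum (u : nat -> C) (n : nat) : Re (Csum u n) = sum_n (fun k => Re (u k)) n.
Proof.
induction n as [| n IH]; [now rewrite Csum_0, sum_O |].
rewrite Csum_S, sum_Sn, <- IH; reflexivity.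
Qed.

Lemma Im_Csum (u : nat -> C) (n : nat) : Im (Csum u n) = sum_n (fun k => Im (u k)) n.
Proof.
induction n as [| n IH]; [now rewrite Csum_0, sum_O |].
rewrite Csum_S, sum_Sn, <- IH; reflexivity.
Qed.

Lemma is_Cseries_Clim (u : nat -> C) (l : C) :
  Clim_seq (Csum u) l -> is_series (V := CR) u l.
Proof.
intros H; apply (filterlim_C_dom eventually _ (fun n => Cmod (Csum u n - l))); [| exact H].
apply filter_forall; intros n; apply Rle_refl.
Qed.

Lemma Cseries_unique (u : nat -> C) (l : C) : Clim_seq (Csum u) l -> Cseries u = l.
Proof.
intros H; apply is_Cseries_Clim in H.
apply (iota_filterlim_locally (V := CRc) (F := eventually)), H.
Qed.

Lemma ex_Cseries_bounded (u : nat -> C) :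
  ex_Cseries u -> exists M, forall n, Cmod (u n) <= M.
Proof.
intros [l Hl].
destruct (filterlim_bounded (V := CR) (Csum u)) as [M HM]; [now exists l |].
exists (M + M); intros [| n].
- rewrite <- Csum_0, <- norm_Cmod.
  pose proof (HM O); pose proof (norm_ge_0 (V := CR) (Csum u 0)); lra.
- replace (u (S n)) with (Csum u (S n) + - Csum u n)%C by (rewrite Csum_S; ring).
  eapply Rle_trans; [apply Cmod_triangle |]; rewrite Cmod_opp, <- !norm_Cmod.
  apply Rplus_le_compat; apply HM.
Qed.

(* The power series with coefficients [c] converges absolutely on [(0, T)]. *)
Definition Cradius_ge (c : nat -> C) (T : Rbar) : Prop :=
  forall r, 0 < r -> Rbar_lt r T -> exists M, forall k, Cmod (c k) * r ^ k <= M.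

Lemma Rbar_between (r : R) (T : Rbar) : Rbar_lt r T -> exists r', r < r' /\ Rbar_lt r' T.
Proof.
destruct T as [T | |]; cbn; intros H.
- exists ((r + T) / 2); lra.
- exists (r + 1); split; [lra | easy].
- easy.
Qed.

(** Two real power series rather than a complex limit, so that convergence and term-by-term
    differentiation come from the real theory. *)
Definition CPSeries (c : nat -> C) (t : R) : C :=
  (PSeries (fun k => Re (c k)) t, PSeries (fun k => Im (c k)) t).

(** Bounded terms at a radius strictly between t and [T] put t strictly inside the disk of
    convergence. [d] stands for the real parts, imaginary parts or moduli of [c]. *)
Lemma CV_radius_component (c : nat -> C) (d : nat -> R) (T : Rbar) (t : R) :
  Cradius_ge c T -> (forall k, Rabs (d k) <= Cmod (c k)) -> 0 < t -> Rbar_lt t T ->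
  Rbar_lt (Rabs t) (CV_radius d).
Proof.
intros Hc Hd Ht HtT; destruct (Rbar_between t T HtT) as [r [Hr HrT]].
rewrite Rabs_pos_eq by lra.
apply Rbar_lt_le_trans with r; [exact Hr |].
apply (proj1 (CV_radius_bounded d)).
destruct (Hc r ltac:(lra) HrT) as [M HM]; exists M; intros k.
rewrite Rabs_mult, (Rabs_pos_eq (r ^ k)) by (apply pow_le; lra).
eapply Rle_trans; [| apply (HM k)].
apply Rmult_le_compat_r; [apply pow_le; lra | apply Hd].
Qed.

Lemma CPSeries_correct (c : nat -> C) (T : Rbar) (t : R) :
  Cradius_ge c T -> 0 < t -> Rbar_lt t T ->
  Clim_seq (Csum (fun k => c k * RtoC (t ^ k))%C) (CPSeries c t).
Proof.
intros Hc Ht HtT.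
pose proof (CV_radius_component c _ T t Hc (fun k => re_le_Cmod (c k)) Ht HtT) as R1.
pose proof (CV_radius_component c _ T t Hc (fun k => im_le_Cmod (c k)) Ht HtT) as R2.
apply CV_radius_inside, PSeries_correct in R1; apply CV_radius_inside, PSeries_correct in R2.
assert (A : forall (d : nat -> R) (l : R), is_pseries d t l ->
  is_lim_seq (fun n => Rabs (sum_n (fun k => d k * t ^ k) n - l)) 0).
{ intros d l H; apply (proj1 (is_lim_seq_abs_0 _)).
  replace 0 with (l - l) by ring.
  apply is_lim_seq_minus'; [| apply is_lim_seq_const].
  apply is_lim_seq_ext with (2 := H); intros n; apply sum_n_ext; intros k.
  rewrite pow_n_pow; unfold scal; cbn; unfold mult; cbn; ring. }
apply A in R1; apply A in R2.
apply (Clim_seq_dom _ _ _ (filter_forall _ (fun n => Cmod_le_Re_Im _))).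
replace 0 with (0 + 0) by ring; apply is_lim_seq_plus'.
- apply is_lim_seq_ext with (2 := R1); intros n.
  unfold Cminus, Cplus, Copp; cbn [Re fst]; fold (Re (Csum (fun k => c k * RtoC (t ^ k))%C n)).
  rewrite Re_Csum; unfold Rminus; do 2 f_equal; apply sum_n_ext; intros k;
  unfold Re, Cmult, RtoC; cbn; ring.
- apply is_lim_seq_ext with (2 := R2); intros n.
  unfold Cminus, Cplus, Copp; cbn [Im snd]; fold (Im (Csum (fun k => c k * RtoC (t ^ k))%C n)).
  rewrite Im_Csum; unfold Rminus; do 2 f_equal; apply sum_n_ext; intros k;
  unfold Im, Cmult, RtoC; cbn; ring.
Qed.

(** The derivative is described through t D because its coefficients k c_k keep the index unshifted
    and combine linearly with the c_k. *)
Lemma Cderive_CPSeries (c : nat -> C) (T : Rbar) (t : R) :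
  Cradius_ge c T -> 0 < t -> Rbar_lt t T ->
  exists D : C, Cderive (CPSeries c) t D /\
    (RtoC t * D)%C = CPSeries (fun k => RtoC (INR k) * c k)%C t.
Proof.
intros Hc Ht HtT.
pose proof (CV_radius_component c _ T t Hc (fun k => re_le_Cmod (c k)) Ht HtT) as R1.
pose proof (CV_radius_component c _ T t Hc (fun k => im_le_Cmod (c k)) Ht HtT) as R2.
eexists; split.
{ apply Cderive_pair; apply is_derive_PSeries; [exact R1 | exact R2]. }
assert (A : forall d : nat -> R, t * PSeries (PS_derive d) t = PSeries (fun k => INR k * d k) t).
{ intros d; rewrite <- PSeries_incr_1; apply PSeries_ext; intros [| k]; cbn;
  [rewrite Rmult_0_l; reflexivity | reflexivity]. }
unfold CPSeries, Cmult, RtoC at 1; cbn [fst snd].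
f_equal; rewrite !Rmult_0_l, ?Rminus_0_r, ?Rplus_0_r, A; apply PSeries_ext; intros k;
  unfold Re, Im, Cmult, RtoC; cbn; ring.
Qed.

Lemma Clim_seq_plus (u v : nat -> C) (l m : C) :
  Clim_seq u l -> Clim_seq v m -> Clim_seq (fun n => u n + v n)%C (l + m)%C.
Proof.
intros Hu Hv; apply (Clim_seq_dom _ _ (fun n => Cmod (u n - l) + Cmod (v n - m))).
- apply filter_forall; intros n.
  replace (u n + v n - (l + m))%C with (u n - l + (v n - m))%C by ring; apply Cmod_triangle.
- replace 0 with (0 + 0) by ring; now apply is_lim_seq_plus'.
Qed.

Lemma CPSeries_lin (a : C) (c d e : nat -> C) (T : Rbar) (t : R) :
  Cradius_ge c T -> Cradius_ge d T -> Cradius_ge e T -> 0 < t -> Rbar_lt t T ->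
  (forall k, e k = a * c k + d k)%C -> (CPSeries e t = a * CPSeries c t + CPSeries d t)%C.
Proof.
intros Hc Hd He Ht HtT E.
apply (Clim_seq_unique _ _ _ (CPSeries_correct e T t He Ht HtT)).
assert (L := Clim_seq_plus _ _ _ _ (Clim_seq_mult _ _ _ _ (Clim_seq_const a)
  (CPSeries_correct c T t Hc Ht HtT)) (CPSeries_correct d T t Hd Ht HtT)).
revert L; apply Clim_seq_ext_loc; apply filter_forall; intros n.
rewrite <- Csum_lin; apply Csum_ext; intros k; rewrite E; ring.
Qed.

(** Subexponential growth of [q] is absorbed by enlarging r slightly to some r' below [T], with
    theta = r' / r. *)
Lemma Cradius_ge_mult (c q : nat -> C) (T : Rbar) :
  Cradius_ge c T ->
  (forall theta, 1 < theta -> exists M, forall k, Cmod (q k) <= M * theta ^ k) ->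
  Cradius_ge (fun k => q k * c k)%C T.
Proof.
intros Hc Hq r Hr HrT; destruct (Rbar_between r T HrT) as [r' [Hr' HrT']].
destruct (Hc r' ltac:(lra) HrT') as [M HM].
assert (Ht : 1 < r' / r).
{ apply (Rmult_lt_reg_r r); trivial; unfold Rdiv; rewrite Rmult_assoc, Rinv_l; lra. }
destruct (Hq _ Ht) as [N HN].
exists (N * M); intros k.
assert (HN0 : 0 <= N).
{ pose proof (HN O) as H; cbn in H; pose proof (Cmod_ge_0 (q O)); lra. }
apply Rle_trans with (N * (r' / r) ^ k * Cmod (c k) * r ^ k).
- rewrite Cmod_mult; apply Rmult_le_compat_r; [apply pow_le; lra |].
  apply Rmult_le_compat_r; [apply Cmod_ge_0 | apply HN].
- replace (N * (r' / r) ^ k * Cmod (c k) * r ^ k) with (N * (Cmod (c k) * ((r' / r) * r) ^ k))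
    by (rewrite Rpow_mult_distr; ring).
  replace (r' / r * r) with r' by (field; lra).
  now apply Rmult_le_compat_l.
Qed.

Lemma geometric_bound (q : nat -> C) (theta : R) (N : nat) : 1 <= theta ->
  (forall k, (N <= k)%nat -> Cmod (q (S k)) <= theta * Cmod (q k)) ->
  exists M, forall k, Cmod (q k) <= M * theta ^ k.
Proof.
intros Ht Hq.
assert (P : forall k, 1 <= theta ^ k) by (intros; now apply pow_R1_Rle).
assert (HF : exists M, 0 <= M /\ forall k, (k <= N)%nat -> Cmod (q k) <= M).
{ clear Hq; induction N as [| N [M [HM IH]]].
  - exists (Cmod (q O)); split; [apply Cmod_ge_0 |].
    intros k Hk; replace k with O by lia; lra.
  - exists (M + Cmod (q (S N))); pose proof (Cmod_ge_0 (q (S N))); split; [lra |].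
    intros k Hk; destruct (Nat.eq_dec k (S N)) as [-> |]; [lra |].
    specialize (IH k ltac:(lia)); lra. }
destruct HF as [M [HM HF]]; exists M; intros k; induction k as [| k IH].
- cbn; specialize (HF O ltac:(lia)); lra.
- destruct (le_lt_dec (S k) N) as [H | H].
  + specialize (HF (S k) H); specialize (P (S k)); nra.
  + eapply Rle_trans; [apply Hq; lia |]; cbn; nra.
Qed.

Lemma poch_ratio_bound (rho sigma : C) : ~ nonpos_int sigma ->
  forall theta, 1 < theta ->
  exists M, forall k, Cmod (poch rho k / poch sigma k)%C <= M * theta ^ k.
Proof.
intros Hs theta Ht.
set (d := Cmod (rho - sigma)); assert (Hd : 0 <= d) by apply Cmod_ge_0.
(* |rho + k| / |sigma + k| <= 1 + d / |sigma + k|, which is at most theta once Re sigma + k exceeds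
   d / (theta - 1). *)
destruct (is_lim_seq_INR_eventually (d / (theta - 1) - Re sigma)) as [N HN].
apply (geometric_bound _ theta N); [lra |].
intros k Hk; specialize (HN k Hk).
pose proof (poch_neq_0_gen sigma k Hs) as N1; pose proof (poch_neq_0_gen sigma (S k) Hs) as N2.
cbn [poch] in *.
assert (N3 : (sigma + RtoC (INR k))%C <> 0) by (intros E; apply N2; rewrite E; ring).
replace (poch rho k * (rho + RtoC (INR k)) / (poch sigma k * (sigma + RtoC (INR k))))%C
  with ((rho + RtoC (INR k)) / (sigma + RtoC (INR k)) * (poch rho k / poch sigma k))%C
  by (field; now split).
rewrite Cmod_mult; apply Rmult_le_compat_r; [apply Cmod_ge_0 |].
rewrite Cmod_div by trivial.
assert (B : d / (theta - 1) <= Cmod (sigma + RtoC (INR k))).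
{ eapply Rle_trans; [| apply Re_le_Cmod]; rewrite Re_plus_INR; lra. }
assert (B' : d <= (theta - 1) * Cmod (sigma + RtoC (INR k))).
{ apply (Rmult_le_compat_l (theta - 1)) in B; [| lra].
  replace ((theta - 1) * (d / (theta - 1))) with d in B by (field; lra); exact B. }
assert (T : Cmod (rho + RtoC (INR k)) <= d + Cmod (sigma + RtoC (INR k))).
{ replace (rho + RtoC (INR k))%C with (rho - sigma + (sigma + RtoC (INR k)))%C by ring.
  apply Cmod_triangle. }
apply (Rmult_le_reg_r (Cmod (sigma + RtoC (INR k)))); [now apply Cmod_gt_0 |].
unfold Rdiv; rewrite Rmult_assoc, Rinv_l, Rmult_1_r by (apply Rgt_not_eq, Cmod_gt_0, N3).
lra.
Qed.

(** * Fractional integrals and derivatives of power series *)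

Lemma Cmod_Csum_sub_le (u : nat -> C) (b : nat -> R) (N m : nat) :
  (forall k, Cmod (u k) <= b k) ->
  Cmod (Csum u (N + m) - Csum u N) <= sum_n b (N + m) - sum_n b N.
Proof.
intros H; induction m as [| m IH].
- rewrite Nat.add_0_r; unfold Cminus; rewrite Cplus_opp_r, Cmod_0; lra.
- assert (E : sum_n b (S (N + m)) = sum_n b (N + m) + b (S (N + m)))
    by exact (sum_Sn (G := R_AbelianMonoid) b (N + m)).
  rewrite Nat.add_succ_r, Csum_S, E.
  replace (Csum u (N + m) + u (S (N + m)) - Csum u N)%C
    with (Csum u (N + m) - Csum u N + u (S (N + m)))%C by ring.
  eapply Rle_trans; [apply Cmod_triangle |].
  specialize (H (S (N + m))); lra.
Qed.

(** Tail estimate of the Weierstrass test: the bound depends on [b] alone, hence is uniform when [u]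
    varies with t. *)
Lemma Cmod_tail_le (u : nat -> C) (b : nat -> R) (l : C) (B : R) (N : nat) :
  (forall k, Cmod (u k) <= b k) -> Clim_seq (Csum u) l -> is_series b B ->
  Cmod (l - Csum u N) <= B - sum_n b N.
Proof.
intros H Hl HB.
assert (HB' : is_lim_seq (sum_n b) B) by exact HB.
apply (is_lim_seq_le_loc (fun _ => Cmod (l - Csum u N))
  (fun n => Cmod (Csum u n - l) + (sum_n b n - sum_n b N))
  (Finite (Cmod (l - Csum u N))) (Finite (B - sum_n b N))).
- exists N; intros n Hn; replace n with (N + (n - N))%nat by lia.
  pose proof (Cmod_Csum_sub_le u b N (n - N) H).
  set (m := (N + (n - N))%nat) in *.
  replace (l - Csum u N)%C with (- (Csum u m - l) + (Csum u m - Csum u N))%C by ring.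
  eapply Rle_trans; [apply Cmod_triangle |]; rewrite Cmod_opp; lra.
- apply is_lim_seq_const.
- replace (B - sum_n b N) with (0 + (B - sum_n b N)) by ring.
  apply is_lim_seq_plus'; [exact Hl |].
  apply is_lim_seq_minus'; [exact HB' | apply is_lim_seq_const].
Qed.

Lemma Cradius_ge_abs_series (c : nat -> C) (T : Rbar) (r : R) :
  Cradius_ge c T -> 0 < r -> Rbar_lt r T -> ex_series (fun k => Cmod (c k) * r ^ k).
Proof.
intros Hc Hr HrT.
assert (H := CV_disk_inside (fun k => Cmod (c k)) r).
eapply ex_series_ext; [| apply H].
- intros k; cbv beta; apply Rabs_pos_eq, Rmult_le_pos; [apply Cmod_ge_0 | apply pow_le; lra].
- apply (CV_radius_component c _ T); trivial.
  intros k; rewrite Rabs_pos_eq; [apply Rle_refl | apply Cmod_ge_0].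
Qed.

Section Interchange.

Variables (a y : R) (rho mu : C) (c : nat -> C) (T : Rbar).
Hypotheses (Hay : a < y) (HT : Rbar_lt (y - a) T) (Hc : Cradius_ge c T).
Hypotheses (Hrho : 0 < Re rho) (Hmu : 0 < Re mu).

Let W (t : R) : C := (Rcpow (t - a) (rho - 1) * Rcpow (y - t) (mu - 1))%C.
(** (t - a)^k merges with (t - a)^(rho - 1), so the k-th term integrates to a beta value with first
    parameter rho + k. *)
Let term (k : nat) : C :=
  (c k * (Rcpow (y - a) (rho + RtoC (INR k) + mu - 1) * Beta (rho + RtoC (INR k)) mu))%C.

Lemma partial_integral (N : nat) :
  is_RInt_gen (V := CR) (fun t => W t * Csum (fun k => c k * RtoC ((t - a) ^ k)) N)%C
    (at_right a) (at_left y) (Csum term N).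
Proof.
assert (B : forall k, is_RInt_gen (V := CR) (fun t => c k * (RtoC ((t - a) ^ k) * W t))%C
    (at_right a) (at_left y) (term k)).
{ intros k; apply (is_RInt_gen_Cmult (at_right a) (at_left y)).
  assert (Hk : 0 < Re (rho + RtoC (INR k))).
  { rewrite Re_plus_INR; pose proof (pos_INR k); lra. }
  refine (is_RInt_gen_ext_C _ _ _ _ _ _ (ends_segment a y Hay) _
    (Beta_segment a y _ mu Hay Hk Hmu)).
  intros t Ht; unfold W.
  replace (rho + RtoC (INR k) - 1)%C with (RtoC (INR k) + (rho - 1))%C by ring.
  rewrite Rcpow_plus, Rcpow_INR by lra; ring. }
induction N as [| N IH].
- rewrite Csum_0; refine (is_RInt_gen_ext_C _ _ _ _ _ _ (ends_segment a y Hay) _ (B O)).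
  intros t Ht; rewrite Csum_0; ring.
- rewrite Csum_S.
  assert (H := is_RInt_gen_lin _ _ 1 1 _ _ _ _ IH (B (S N))).
  rewrite !Cmult_1_l in H.
  refine (is_RInt_gen_ext_C _ _ _ _ _ _ (ends_segment a y Hay) _ H).
  intros t Ht; rewrite Csum_S; ring.
Qed.

(** The modulus of the weight is the weight with exponents Re rho and Re mu, so its integrability is
    again a beta integral. *)
Lemma dominating_integral : exists G,
  is_RInt_gen (fun t => Rpower (t - a) (Re rho - 1) * Rpower (y - t) (Re mu - 1))
    (at_right a) (at_left y) G.
Proof.
eexists.
refine (is_RInt_gen_ext_on _ _ _ _ _ _ (ends_segment a y Hay) _
  (is_RInt_gen_Re _ _ _ _ (Beta_segment a y (RtoC (Re rho)) (RtoC (Re mu)) Hay Hrho Hmu))).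
intros t Ht; rewrite <- !RtoC_minus, !Rcpow_RtoC, <- RtoC_mult; reflexivity.
Qed.

Lemma Cmod_weight (t : R) :
  Cmod (W t) = Rpower (t - a) (Re rho - 1) * Rpower (y - t) (Re mu - 1).
Proof. unfold W; rewrite Cmod_mult, !Cmod_Rcpow; reflexivity. Qed.

Lemma termwise_integral : exists J : C,
  is_RInt_gen (V := CR) (fun t => W t * CPSeries c (t - a))%C (at_right a) (at_left y) J
  /\ Clim_seq (Csum term) J.
Proof.
destruct dominating_integral as [G HG].
(* The end radius y - a still lies below [T], so absolute convergence there supplies one summable
   majorant for all t in (a, y). *)
destruct (Cradius_ge_abs_series c T (y - a) Hc ltac:(lra) HT) as [B HB].
set (b := fun k => Cmod (c k) * (y - a) ^ k) in *.
assert (Hb : forall t, a < t < y -> forall k, Cmod (c k * RtoC ((t - a) ^ k)) <= b k).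
{ intros t Ht k; unfold b; rewrite Cmod_mult, Cmod_R, Rabs_pos_eq by (apply pow_le; lra).
  apply Rmult_le_compat_l; [apply Cmod_ge_0 | apply pow_incr; lra]. }
assert (HtT : forall t, a < t < y -> Rbar_lt (t - a) T).
{ intros t Ht; apply Rbar_lt_trans with (Finite (y - a)); [cbn; lra | exact HT]. }
assert (Tail : forall N t, a < t < y ->
  Cmod (CPSeries c (t - a) - Csum (fun k => c k * RtoC ((t - a) ^ k))%C N) <= B - sum_n b N).
{ intros N t Ht; apply Cmod_tail_le; [now apply Hb | | exact HB].
  apply (CPSeries_correct c T); [exact Hc | lra | now apply HtT]. }
set (g := fun t => Rpower (t - a) (Re rho - 1) * Rpower (y - t) (Re mu - 1)) in *.
assert (Hg : forall t, 0 <= g t) by (intros t; apply Rmult_le_pos; apply Rlt_le, exp_pos).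
assert (BB : forall t, a < t < y -> Cmod (CPSeries c (t - a)) <= B).
{ intros t Ht; pose proof (Tail O t Ht) as H0; rewrite Csum_0, sum_O in H0.
  replace (CPSeries c (t - a)) with (CPSeries c (t - a) - c O * RtoC ((t - a) ^ 0) +
    c O * RtoC ((t - a) ^ 0))%C by ring.
  eapply Rle_trans; [apply Cmod_triangle |].
  pose proof (Hb t Ht O); lra. }
destruct (ex_RInt_gen_dom (fun t => a < t < y) (at_right a) (at_left y)
  (fun t => W t * CPSeries c (t - a))%C (fun t => B * g t)) as [J HJ].
- now apply ends_segment.
- intros t Ht.
  pose proof (HtT t Ht) as Htt.
  destruct (Cderive_CPSeries c T (t - a) Hc ltac:(lra) Htt) as [D [HD _]].
  eapply Cderive_continuous, Cderive_mult.
  + apply Cderive_mult.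
    * apply (Cderive_Rcpow _ (fun t => t - a) t 1); [lra | auto_derive; trivial; ring].
    * apply (Cderive_Rcpow _ (fun t => y - t) t (-1)); [lra | auto_derive; trivial; ring].
  + apply (is_derive_comp (V := CR) (CPSeries c) (fun t => t - a) t D 1); [exact HD |].
    auto_derive; trivial; ring.
- intros t Ht; apply (ex_derive_continuous (V := R_NormedModule)); unfold g, Rpower.
  auto_derive; lra.
- intros t Ht; rewrite Cmod_mult, Cmod_weight, Rmult_comm.
  apply Rmult_le_compat_r; [apply Hg | now apply BB].
- exists (scal B G); apply (is_RInt_gen_scal (V := R_NormedModule)), HG.
- exists J; split; [exact HJ |].
  (* The error integrand is the weight times a tail bounded uniformly in t; integration leaves that
     bound times [G]. *)
  apply (Clim_seq_dom _ _ (fun N => (B - sum_n b N) * G)).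
  + apply filter_forall; intros N.
    assert (H := is_RInt_gen_lin _ _ 1 (-1) _ _ _ _ (partial_integral N) HJ).
    replace (Csum term N - J)%C with (1 * Csum term N + -1 * J)%C by ring.
    apply (is_RInt_gen_dom_le (fun t => a < t < y) (at_right a) (at_left y) _
      (fun t => (B - sum_n b N) * g t) _ _ (ends_segment a y Hay)) with (2 := H).
    * intros t Ht.
      replace (1 * _ + _)%C with (- (W t * (CPSeries c (t - a) -
        Csum (fun k => c k * RtoC ((t - a) ^ k)) N)))%C by ring.
      rewrite Cmod_opp, Cmod_mult, Cmod_weight, Rmult_comm.
      apply Rmult_le_compat_r; [apply Hg | now apply Tail].
    * apply (is_RInt_gen_scal (V := R_NormedModule)), HG.
  + replace 0 with ((B - B) * G) by ring.
    apply is_lim_seq_mult'; [| apply is_lim_seq_const].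
    apply is_lim_seq_minus'; [apply is_lim_seq_const | exact HB].
Qed.

End Interchange.

Lemma RL_integral_power_series (a y : R) (rho mu : C) (c : nat -> C) (T : Rbar) :
  a < y -> Rbar_lt (y - a) T -> Cradius_ge c T -> 0 < Re rho -> 0 < Re mu ->
  is_RL_integral a mu (fun t => Rcpow (t - a) (rho - 1) * CPSeries c (t - a))%C y
    (Rcpow (y - a) (rho + mu - 1) * Gamma rho / Gamma (rho + mu) *
     CPSeries (fun k => poch rho k / poch (rho + mu) k * c k) (y - a))%C.
Proof.
intros Hay HT Hc Hrho Hmu.
assert (Hs : 0 < Re (rho + mu)) by (cbn; unfold Re in *; lra).
destruct (termwise_integral a y rho mu c T Hay HT Hc Hrho Hmu) as [J [HJ LJ]].
exists J; split.
{ refine (is_RInt_gen_ext_C _ _ _ _ _ _ (ends_segment a y Hay) _ HJ).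
  intros t Ht; replace (mu - 1)%C with (- (1 - mu))%C by ring.
  rewrite Rcpow_opp; field; apply Rcpow_neq_0. }
(* The extra Gamma(mu) is cancelled by the factor 1 / Gamma(mu) in front of the fractional
   integral. *)
set (K := (Rcpow (y - a) (rho + mu - 1) * Gamma rho / Gamma (rho + mu) * Gamma mu)%C).
pose proof (Gamma_neq_0 _ Hmu) as Nm; pose proof (Gamma_neq_0 _ Hs) as Ns.
enough (E : J = (K * CPSeries (fun k => poch rho k / poch (rho + mu) k * c k) (y - a))%C).
{ rewrite E; unfold K; field; now split. }
apply (Clim_seq_unique _ _ _ LJ).
assert (Hq : Cradius_ge (fun k => poch rho k / poch (rho + mu) k * c k)%C T).
{ apply Cradius_ge_mult; trivial; apply poch_ratio_bound; now apply Re_pos_not_nonpos_int. }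
assert (L := Clim_seq_mult _ _ _ _ (Clim_seq_const K)
  (CPSeries_correct _ T (y - a) Hq ltac:(lra) HT)).
revert L; apply Clim_seq_ext_loc; apply filter_forall; intros n.
transitivity (K * Csum (fun k => poch rho k / poch (rho + mu) k * c k * RtoC ((y - a) ^ k)) n
  + Csum (fun _ => 0) n)%C.
{ rewrite <- (Cplus_0_r (K * _)) at 1; f_equal.
  induction n as [| n IH]; [now rewrite Csum_0 | rewrite Csum_S, <- IH; ring]. }
rewrite <- Csum_lin; apply Csum_ext; intros k; cbv beta.
assert (Hk : 0 < Re (rho + RtoC (INR k))).
{ rewrite Re_plus_INR; pose proof (pos_INR k); lra. }
assert (Hsk : 0 < Re (rho + mu + RtoC (INR k))).
{ rewrite Re_plus_INR; pose proof (pos_INR k); lra. }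
pose proof (Beta_Gamma (rho + RtoC (INR k)) mu Hk Hmu) as E.
replace (rho + RtoC (INR k) + mu)%C with (rho + mu + RtoC (INR k))%C in * by ring.
rewrite <- !Gamma_pos in E by trivial.
rewrite !Gamma_add in E by now apply Re_pos_not_nonpos_int.
pose proof (poch_neq_0 (rho + mu) k Hs) as Np.
assert (E' : Beta (rho + RtoC (INR k)) mu =
  (poch rho k * Gamma rho * Gamma mu / (poch (rho + mu) k * Gamma (rho + mu)))%C).
{ rewrite <- E; field; now split. }
rewrite E'.
replace (rho + mu + RtoC (INR k) - 1)%C with (RtoC (INR k) + (rho + mu - 1))%C by ring.
rewrite Rcpow_plus, Rcpow_INR by lra; unfold K; field; now split.
Qed.

(* Holds unconditionally because [/ 0 = 0] in [C]. *)
Lemma Cinv_mult (z w : C) : (/ (z * w) = / z * / w)%C.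
Proof.
assert (E0 : (/ RtoC 0 = RtoC 0)%C).
{ unfold Cinv, RtoC; cbn; f_equal; unfold Rdiv; ring. }
destruct (Ceq_dec z 0) as [-> | Hz]; [now rewrite Cmult_0_l, E0, Cmult_0_l |].
destruct (Ceq_dec w 0) as [-> | Hw]; [now rewrite Cmult_0_r, E0, Cmult_0_r |].
field; now split.
Qed.

Lemma nonpos_int_pred (z : C) : nonpos_int z -> nonpos_int (z - 1).
Proof.
intros H; apply (nonpos_int_add (z - 1) 1).
replace (z - 1 + RtoC (INR 1))%C with z by (cbn [INR]; ring); exact H.
Qed.

Lemma CPSeries_ext (c d : nat -> C) (t : R) :
  (forall k, c k = d k) -> CPSeries c t = CPSeries d t.
Proof. intros H; unfold CPSeries; f_equal; apply PSeries_ext; intros k; now rewrite H. Qed.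

(** [sigma] is left free: rho + mu gives the fractional integral, and differentiation moves within
    the family by lowering [sigma]. *)
Definition frac_series (a : R) (rho : C) (c : nat -> C) (sigma : C) (u : R) : C :=
  (Rcpow (u - a) (sigma - 1) * Gamma rho / Gamma sigma *
   CPSeries (fun k => poch rho k / poch sigma k * c k) (u - a))%C.

(** Differentiation multiplies the k-th term by sigma - 1 + k, and (sigma - 1 + k) / (sigma)_k =
    (sigma - 1) / (sigma - 1)_k. The factor sigma - 1 cancels against Gamma(sigma) = (sigma - 1)
    Gamma(sigma - 1). *)
Lemma Cderive_frac_series (a : R) (rho sigma : C) (c : nat -> C) (T : Rbar) (u : R) :
  Cradius_ge c T -> ~ nonpos_int (sigma - 1) -> a < u -> Rbar_lt (u - a) T ->
  Cderive (frac_series a rho c sigma) u (frac_series a rho c (sigma - 1) u).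
Proof.
intros Hc Hs1 Hu HT; assert (Ht : 0 < u - a) by lra.
assert (Hs : ~ nonpos_int sigma) by (intros H; now apply Hs1, nonpos_int_pred).
assert (N1 : (sigma - 1)%C <> 0) by (intros H; apply Hs1; rewrite H; apply nonpos_int_0).
set (d := fun k => (poch rho k / poch sigma k * c k)%C).
set (e := fun k => (poch rho k / poch (sigma - 1) k * c k)%C).
assert (Hd : Cradius_ge d T) by (apply Cradius_ge_mult; trivial; now apply poch_ratio_bound).
assert (He : Cradius_ge e T) by (apply Cradius_ge_mult; trivial; now apply poch_ratio_bound).
assert (Id : forall k, ((sigma - 1 + RtoC (INR k)) * d k = (sigma - 1) * e k)%C).
{ intros k; unfold d, e.
  pose proof (poch_succ_l (sigma - 1) k) as E; cbn [poch] in E.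
  replace (sigma - 1 + 1)%C with sigma in E by ring.
  pose proof (poch_neq_0_gen sigma k Hs); pose proof (poch_neq_0_gen _ k Hs1).
  transitivity (poch rho k * c k * (poch (sigma - 1) k * (sigma - 1 + RtoC (INR k))) /
    (poch sigma k * poch (sigma - 1) k))%C; [field; now split |].
  rewrite E; field; now split. }
(* By [Id], k d_k = (sigma - 1) (e_k - d_k), so the bounds for [d] and [e] suffice. *)
assert (Hkd : Cradius_ge (fun k => RtoC (INR k) * d k)%C T).
{ intros r Hr HrT; destruct (He r Hr HrT) as [M HM]; destruct (Hd r Hr HrT) as [M' HM'].
  exists (Cmod (sigma - 1) * M + Cmod (sigma - 1) * M'); intros k.
  assert (Hrk : 0 <= r ^ k) by (apply pow_le; lra).
  replace (RtoC (INR k) * d k)%C with ((sigma - 1) * e k + - (sigma - 1) * d k)%C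
    by (rewrite <- Id; ring).
  apply Rle_trans with (Cmod (sigma - 1) * (Cmod (e k) * r ^ k) +
    Cmod (sigma - 1) * (Cmod (d k) * r ^ k)).
  - rewrite <- !Rmult_assoc, <- Rmult_plus_distr_r; apply Rmult_le_compat_r; trivial.
    eapply Rle_trans; [apply Cmod_triangle |]; rewrite !Cmod_mult, Cmod_opp; lra.
  - apply Rplus_le_compat; (apply Rmult_le_compat_l; [apply Cmod_ge_0 |]); auto. }
destruct (Cderive_CPSeries d T (u - a) Hd Ht HT) as [D [HD ED]].
assert (Sum : (CPSeries e (u - a) =
  / (sigma - 1) * (RtoC (u - a) * D) + CPSeries d (u - a))%C).
{ rewrite ED; apply (CPSeries_lin _ _ _ _ T (u - a) Hkd Hd He Ht HT).
  intros k; transitivity (/ (sigma - 1) * ((sigma - 1) * e k))%C; [field; trivial |].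
  rewrite <- Id; field; trivial. }
assert (HD' : Cderive (fun t => CPSeries d (t - a)) u D).
{ rewrite <- (scal_one (K := R_AbsRing) (V := CR) D).
  apply (is_derive_comp (V := CR) (CPSeries d) (fun t => t - a) u D 1); [exact HD |].
  auto_derive; trivial; ring. }
unfold frac_series; fold d e.
apply (is_derive_ext (V := CR) (fun u => (Gamma rho / Gamma sigma) *
  (Rcpow (u - a) (sigma - 1) * CPSeries d (u - a)))%C).
{ intros t; cbn; unfold Cdiv; ring. }
eapply Cderive_eq.
{ apply Cderive_scal, Cderive_mult.
  - apply (Cderive_Rcpow _ (fun t => t - a) u 1); [lra | auto_derive; trivial; ring].
  - exact HD'. }
cbv beta; rewrite (Rcpow_succ (u - a) (sigma - 1) Ht).
pose proof (Gamma_succ (sigma - 1) Hs1) as EG.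
replace (sigma - 1 + 1)%C with sigma in EG by ring; rewrite EG.
unfold Cdiv; rewrite Sum, Cinv_mult.
transitivity (Gamma rho * / Gamma (sigma - 1) * Rcpow (u - a) (sigma - 1 - 1) *
  (((sigma - 1) * / (sigma - 1)) * CPSeries d (u - a) +
   / (sigma - 1) * (RtoC (u - a) * D)))%C; [ring |].
rewrite Cinv_r by trivial; ring.
Qed.

Lemma locally_interval (a y : R) (Y : Rbar) : a < y -> Rbar_lt y Y ->
  locally y (fun t => a < t /\ Rbar_lt t Y).
Proof.
intros Ha HY; destruct (Rbar_between y Y HY) as [r [H1 H2]].
assert (Hd : 0 < Rmin (y - a) (r - y)) by (apply Rmin_pos; lra).
exists (mkposreal _ Hd); intros t Ht.
unfold ball in Ht; cbn in Ht; unfold AbsRing_ball, abs, minus, plus, opp in Ht; cbn in Ht.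
pose proof (Rmin_l (y - a) (r - y)); pose proof (Rmin_r (y - a) (r - y)).
apply Rabs_def2 in Ht; split; [lra |].
apply Rbar_lt_trans with (Finite r); [cbn; lra | exact H2].
Qed.

Lemma Rbar_lt_minus (t a : R) (Y : Rbar) :
  Rbar_lt t Y <-> Rbar_lt (t - a) (Rbar_minus Y a).
Proof. destruct Y; cbn; try tauto; lra. Qed.

(** A condition on the final parameter protects the intermediate ones: if some sigma - j were a
    nonpositive integer, so would be every later one. *)
Lemma is_Cderive_n_frac_series (a : R) (rho sigma : C) (c : nat -> C) (Y : Rbar) (n : nat) :
  Cradius_ge c (Rbar_minus Y a) -> ~ nonpos_int (sigma - RtoC (INR n)) ->
  forall u, a < u -> Rbar_lt u Y ->
  is_Cderive_n (frac_series a rho c sigma) n u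
    (frac_series a rho c (sigma - RtoC (INR n)) u).
Proof.
intros Hc; induction n as [| n IH]; intros Hs u Hu HY; cbn [is_Cderive_n].
- f_equal; cbn; ring.
- replace (sigma - RtoC (INR (S n)))%C with (sigma - RtoC (INR n) - 1)%C in *
    by (rewrite S_INR, RtoC_plus; ring).
  assert (Hs' : ~ nonpos_int (sigma - RtoC (INR n))) by (intros H; now apply Hs, nonpos_int_pred).
  exists (frac_series a rho c (sigma - RtoC (INR n))); split.
  + generalize (locally_interval a u Y Hu HY); apply filter_imp.
    intros t [H1 H2]; now apply IH.
  + apply (Cderive_frac_series a rho _ c (Rbar_minus Y a)); trivial.
    now apply Rbar_lt_minus.
Qed.

Lemma is_RL_integral_ext (a y : R) (mu : C) (f g : R -> C) (v : C) : a < y ->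
  (forall t, a < t < y -> f t = g t) ->
  is_RL_integral a mu f y v -> is_RL_integral a mu g y v.
Proof.
intros Hay E [J [HJ Hv]]; exists J; split; [| exact Hv].
refine (is_RInt_gen_ext_C _ _ _ _ _ _ (ends_segment a y Hay) _ HJ).
intros t Ht; now rewrite E.
Qed.

(** * From power series back to hypergeometric series *)

Definition rGs_coeff (x : R) (p alpha1 : C) (alphas betas : list C) (omega : C) (k : nat) : C :=
  (inc_poch alpha1 x p (RtoC (INR k)) * poch_prod alphas k / poch_prod betas k
   * (omega ^ k / RtoC (INR (fact k))))%C.

Lemma rGs_term_coeff (x : R) (p alpha1 : C) (alphas betas : list C) (omega : C) (t : R) (k : nat) :
  rGs_term x p alpha1 alphas betas (omega * RtoC t) k =
  (rGs_coeff x p alpha1 alphas betas omega k * RtoC (t ^ k))%C.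
Proof. unfold rGs_term, rGs_coeff; rewrite Cpow_mult_l, RtoC_pow; unfold Cdiv; ring. Qed.

Lemma poch_prod_app (l : list C) (b : C) (n : nat) :
  poch_prod (l ++ [b]) n = (poch_prod l n * poch b n)%C.
Proof. induction l as [| d l IH]; cbn; [ring |]; unfold poch_prod in IH; rewrite IH; ring. Qed.

Lemma rGs_coeff_app (x : R) (p alpha1 : C) (alphas betas : list C) (rho sigma omega : C) (k : nat) :
  rGs_coeff x p alpha1 (alphas ++ [rho]) (betas ++ [sigma]) omega k =
  (poch rho k / poch sigma k * rGs_coeff x p alpha1 alphas betas omega k)%C.
Proof.
unfold rGs_coeff; rewrite !poch_prod_app; unfold Cdiv; rewrite Cinv_mult; ring.
Qed.

(** Convergence at the real point a + r bounds the terms |c_k| r^k, which is all that [Cradius_ge]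
    asks at r. *)
Lemma rGs_coeff_radius (x : R) (p alpha1 : C) (alphas betas : list C) (omega : C)
  (a : R) (Y : Rbar) :
  (forall t : R, a < t -> Rbar_lt (Finite t) Y ->
     ex_rGs x p alpha1 alphas betas (omega * RtoC (t - a))%C) ->
  Cradius_ge (rGs_coeff x p alpha1 alphas betas omega) (Rbar_minus Y a).
Proof.
intros H r Hr HrT.
assert (HY : Rbar_lt (a + r) Y).
{ apply (Rbar_lt_minus _ a); now replace (a + r - a) with r by ring. }
destruct (ex_Cseries_bounded _ (H (a + r) ltac:(lra) HY)) as [M HM].
exists M; intros k; specialize (HM k); rewrite rGs_term_coeff in HM.
replace (a + r - a) with r in HM by ring.
rewrite Cmod_mult, Cmod_R, Rabs_pos_eq in HM by (apply pow_le; lra); exact HM.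
Qed.

Lemma rGs_CPSeries (x : R) (p alpha1 : C) (alphas betas : list C) (omega : C) (T : Rbar) (t : R) :
  Cradius_ge (rGs_coeff x p alpha1 alphas betas omega) T -> 0 < t -> Rbar_lt t T ->
  ex_rGs x p alpha1 alphas betas (omega * RtoC t) /\
  rGs x p alpha1 alphas betas (omega * RtoC t) =
    CPSeries (rGs_coeff x p alpha1 alphas betas omega) t.
Proof.
intros Hc Ht HtT.
assert (L : Clim_seq (Csum (rGs_term x p alpha1 alphas betas (omega * RtoC t)))
  (CPSeries (rGs_coeff x p alpha1 alphas betas omega) t)).
{ generalize (CPSeries_correct _ T t Hc Ht HtT); apply Clim_seq_ext_loc.
  apply filter_forall; intros n; apply Csum_ext; intros k; now rewrite rGs_term_coeff. }
split; [eexists; exact (is_Cseries_Clim _ _ L) | exact (Cseries_unique _ _ L)].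
Qed.

Lemma rGs_app_CPSeries (x : R) (p alpha1 : C) (alphas betas : list C) (omega rho sigma : C)
  (T : Rbar) (t : R) :
  Cradius_ge (rGs_coeff x p alpha1 alphas betas omega) T -> ~ nonpos_int sigma ->
  0 < t -> Rbar_lt t T ->
  ex_rGs x p alpha1 (alphas ++ [rho]) (betas ++ [sigma]) (omega * RtoC t) /\
  rGs x p alpha1 (alphas ++ [rho]) (betas ++ [sigma]) (omega * RtoC t) =
    CPSeries (fun k => poch rho k / poch sigma k *
      rGs_coeff x p alpha1 alphas betas omega k)%C t.
Proof.
intros Hc Hs Ht HtT.
rewrite <- (CPSeries_ext _ _ t
  (fun k => rGs_coeff_app x p alpha1 alphas betas rho sigma omega k)).
apply (rGs_CPSeries _ _ _ _ _ _ T); trivial.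
intros r Hr HrT.
destruct (Cradius_ge_mult _ _ T Hc (poch_ratio_bound rho sigma Hs) r Hr HrT) as [M HM].
exists M; intros k; rewrite rGs_coeff_app; apply HM.
Qed.

(** Re mu < [Re mu] + 1 is strict, so the inner integral has an order of positive real part even
    when Re mu is an integer; [Re mu] >= 0 makes [Z.to_nat] exact. *)
Lemma Re_RL_order_sub (mu : C) : 0 < Re mu -> 0 < Re (RtoC (INR (RL_order mu)) - mu).
Proof.
intros Hmu; unfold RL_order.
destruct (base_Int_part (Re mu)) as [H1 H2].
assert (H : (-1 < Int_part (Re mu))%Z) by (apply lt_IZR; lra).
rewrite INR_IZR_INZ, Z2Nat.id by lia; rewrite plus_IZR.
cbn; unfold Re in *; lra.
Qed.

Theorem theorem6 :
  forall (alpha1 : C) (alphas betas : list C) (x a : R) (rho mu omega p : C)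
    (Y : Rbar),
  (forall b : C, In b betas -> ~ nonpos_int b) ->
  0 <= x -> 0 <= a ->
  0 < Re rho -> 0 < Re mu -> 0 < Re p ->
  Rbar_lt (Finite a) Y ->
  (forall t : R, a < t -> Rbar_lt (Finite t) Y ->
     ex_rGs x p alpha1 alphas betas (omega * RtoC (t - a))%C) ->
  forall y : R, a < y -> Rbar_lt (Finite y) Y ->
  let phi := fun t : R =>
    (Rcpow (t - a) (rho - 1)
     * rGs x p alpha1 alphas betas (omega * RtoC (t - a)))%C in
  (ex_rGs x p alpha1 (alphas ++ [rho]) (betas ++ [(rho + mu)%C])
     (omega * RtoC (y - a))%C
   /\ is_RL_integral a mu phi y
        (Rcpow (y - a) (rho + mu - 1) * Gamma rho / Gamma (rho + mu)
         * rGs x p alpha1 (alphas ++ [rho]) (betas ++ [(rho + mu)%C])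
             (omega * RtoC (y - a)))%C)
  /\
  (~ nonpos_int (rho - mu)%C ->
   ex_rGs x p alpha1 (alphas ++ [rho]) (betas ++ [(rho - mu)%C])
     (omega * RtoC (y - a))%C
   /\ is_RL_derivative a mu phi y
        (Rcpow (y - a) (rho - mu - 1) * Gamma rho / Gamma (rho - mu)
         * rGs x p alpha1 (alphas ++ [rho]) (betas ++ [(rho - mu)%C])
             (omega * RtoC (y - a)))%C).
Proof.
intros alpha1 alphas betas x a rho mu omega p Y _ _ _ Hrho Hmu _ _ Hser y Hy HY phi.
set (c := rGs_coeff x p alpha1 alphas betas omega).
assert (Hc : Cradius_ge c (Rbar_minus Y a)) by now apply rGs_coeff_radius.
assert (Rng : forall u, a < u -> Rbar_lt u Y -> 0 < u - a /\ Rbar_lt (u - a) (Rbar_minus Y a)).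
{ intros u Hu HuY; split; [lra | now apply Rbar_lt_minus]. }
destruct (Rng y Hy HY) as [Hya HyaT].
(* Order and point are generic because the derivative needs the integral of order n - mu at all
   points near [y]. *)
assert (RL : forall nu u, 0 < Re nu -> a < u -> Rbar_lt u Y ->
  is_RL_integral a nu phi u (frac_series a rho c (rho + nu) u)).
{ intros nu u Hnu Hu HuY; destruct (Rng u Hu HuY) as [H1 H2].
  apply is_RL_integral_ext with (3 := RL_integral_power_series a u rho nu c _ Hu H2 Hc Hrho Hnu);
    [exact Hu |].
  intros t Ht; unfold phi; f_equal; symmetry.
  apply (rGs_CPSeries _ _ _ _ _ _ (Rbar_minus Y a)); [exact Hc | lra |].
  apply Rbar_lt_minus, Rbar_lt_trans with (Finite u); [cbn; lra | exact HuY]. }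
split.
- assert (Hs : ~ nonpos_int (rho + mu)).
  { apply Re_pos_not_nonpos_int; cbn; unfold Re in *; lra. }
  destruct (rGs_app_CPSeries x p alpha1 alphas betas omega rho _ _ (y - a) Hc Hs Hya HyaT)
    as [Hex E].
  split; [exact Hex |].
  rewrite E; now apply RL.
- intros Hs.
  destruct (rGs_app_CPSeries x p alpha1 alphas betas omega rho _ _ (y - a) Hc Hs Hya HyaT)
    as [Hex E].
  split; [exact Hex |].
  set (n := RL_order mu); set (nu := (RtoC (INR n) - mu)%C).
  exists (frac_series a rho c (rho + nu)); split.
  + generalize (locally_interval a y Y Hy HY); apply filter_imp.
    intros u [H1 H2]; apply RL; trivial; now apply Re_RL_order_sub.
  + rewrite E.
    (* With nu = n - mu, n differentiations lower the parameter rho + nu exactly to rho - mu. *)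
    assert (Ed : (rho - mu = rho + nu - RtoC (INR n))%C) by (unfold nu; ring).
    rewrite Ed in Hs |- *.
    exact (is_Cderive_n_frac_series a rho (rho + nu) c Y n Hc Hs y Hy HY).
Qed.
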